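(* Let $n\ge2$ and let $\Omega$ be a bounded $s$-John domain in $\mathbb{R}^n$ with $1\le s<n/(n-1)$, and let $\delta\in(0,n]$. If $u\in C^1(\Omega)$, then for every $t>0$ \[ \inf_{b\in\mathbb{R}}\mathcal{H}^{\delta}_\infty\big(\{x\in\Omega: |u(x)-b|>t\}\big)\le c\,t^{-\frac{\delta}{s(n-1)}}\Big(\int_\Omega|\nabla u(x)|^{\delta/n}\,d\mathcal{H}^{\delta}_\infty\Big)^{\frac{n}{s(n-1)}}, \] where $c$ is a constant depending only on $n,\delta,\Omega$.
   Context: Let $s\ge1$. A bounded domain (open connected set) $\Omega\subset\mathbb{R}^n$ is an $s$-John domain if there are finite positive constants $c_J,C_J$ and a point $x_0\in\Omega$ such that every $x\in\Omega$ can be joined to $x_0$ by a rectifiable curve $\gamma_x:[0,\ell(\gamma_x)]\to\Omega$ parametrised by arc length with $\gamma_x(0)=x$, $\gamma_x(\ell(\gamma_x))=x_0$, $\ell(\gamma_x)\le C_J$, and $\operatorname{dist}(\gamma_x(t),\partial\Omega)\ge c_J t^s$ for all $t\in[0,\ell(\gamma_x)]$. For $E\subset\mathbb{R}^n$ and $\beta\in(0,n]$, $\mathcal{H}^{\beta}_\infty(E)=\inf\{\sum_i r_i^{\beta}: E\subset\bigcup_i B(x_i,r_i)\}$ over countable or finite coverings by open balls. For $f:\Omega\to[0,\infty]$, $\int_\Omega f\,d\mathcal{H}^{\beta}_\infty:=\int_0^\infty \mathcal{H}^{\beta}_\infty(\{x\in\Omega: f(x)>t\})\,dt$. *)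

(* Defs.v *)
From HB Require Import structures.
From mathcomp Require Import all_boot all_order all_algebra.
From mathcomp Require Import all_classical all_reals all_analysis.
Set Implicit Arguments. Unset Strict Implicit. Unset Printing Implicit Defensive.
Import Order.TTheory GRing.Theory Num.Theory numFieldNormedType.Exports.
Local Open Scope classical_set_scope.
Local Open Scope ring_scope.

Section Defs.
Variables (R : realType) (n : nat).
Notation V := 'rV[R]_n.

Definition enorm (v : V) : R := Num.sqrt (\sum_(i < n) v ord0 i ^+ 2).

Definition eball (x : V) (r : R) : set V := [set y | enorm (y - x) < r].

(* Hausdorff content H^beta_infty: inf of sum r_i^beta over countable
   coverings by open balls (finite coverings are padded with radius-0 balls,
   which are empty and contribute 0). *)
Definition hcontent (beta : R) (E : set V) : \bar R :=
  ereal_inf [set (\sum_(0 <= i <oo) ((r i) `^ beta)%:E)%E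
            | r in [set r : nat -> R | exists c : nat -> V,
                      (forall i, 0 <= r i) /\ E `<=` \bigcup_i eball (c i) (r i)]].

Definition choquet (beta : R) (Om : set V) (f : V -> R) : \bar R :=
  (\int[@lebesgue_measure R]_(t in `[0%R, +oo[%classic)
      hcontent beta [set x | Om x /\ (t < f x)%R])%E.

Definition bdry (Om : set V) : set V := closure Om `\` Om.
Definition dist_bdry (Om : set V) (y : V) : R :=
  inf [set enorm (y - z) | z in bdry Om].

Definition curve_length (g : R -> V) (a b : R) : \bar R :=
  ereal_sup [set L | exists (k : nat) (p : nat -> R),
              p 0%N = a /\ p k = b /\ (forall i, (i < k)%N -> p i <= p i.+1) /\
              L = (\sum_(i < k) enorm (g (p i.+1) - g (p i)))%:E].

Definition arclength_param (g : R -> V) (l : R) : Prop :=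
  0 <= l /\ forall a b, 0 <= a -> a <= b -> b <= l ->
    curve_length g a b = (b - a)%:E.

Definition bounded_domain (Om : set V) : Prop :=
  open Om /\ connected Om /\ Om !=set0 /\
  exists M : R, forall x, Om x -> enorm x <= M.

Definition s_john (s : R) (Om : set V) : Prop :=
  bounded_domain Om /\
  exists cJ CJ : R, 0 < cJ /\ 0 < CJ /\
  exists x0 : V, Om x0 /\
  forall x, Om x -> exists (g : R -> V) (l : R),
    arclength_param g l /\ g 0 = x /\ g l = x0 /\ l <= CJ /\
    (forall t, 0 <= t <= l -> Om (g t)) /\
    (forall t, 0 <= t <= l -> cJ * t `^ s <= dist_bdry Om (g t)).

Definition evec (i : 'I_n) : V := delta_mx 0 i.
Definition partial (u : V -> R) (i : 'I_n) (x : V) : R := 'D_(evec i) u x.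

Definition C1_on (Om : set V) (u : V -> R) : Prop :=
  forall i : 'I_n, (forall x, Om x -> derivable u x (evec i)) /\
                   {within Om, continuous (partial u i)}.

Definition grad_norm (u : V -> R) (x : V) : R :=
  Num.sqrt (\sum_(i < n) partial u i x ^+ 2).

End Defs.

(* Main.v *)
Require Import Defs.
From HB Require Import structures.
From mathcomp Require Import all_boot all_order all_algebra.
From mathcomp Require Import all_classical all_reals all_analysis.
From mathcomp Require Import measurable_realfun.
From mathcomp Require Import ring lra zify.
Import Order.TTheory GRing.Theory Num.Theory numFieldNormedType.Exports.
Local Open Scope classical_set_scope.
Local Open Scope ring_scope.

(** The gradient norm [g] is dominated by a countable sum of weighted balls
    [a_j 1_{B(x_j, r_j)}] with [sum_j a_j^(delta/n) r_j^delta] bounded by the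
    Choquet integral of [g^(delta/n)]: cover each dyadic superlevel set of [g]
    almost optimally.  From then on the Choquet integral is replaced by the
    point masses [m_j = a_j r_j^n] at [x_j], which are additive, and whose powers
    [m_j^(delta/n)] are still summable because [delta/n <= 1].

    Pointwise bound: along the John curve from [x] to the centre one chains
    lattice cubes of side about [t^s] at arc length [t], and compares the averages
    of [u] over consecutive cubes by moving one cube to the next.  No Lebesgue
    measure on R^n is needed: averages are taken over grids of [N^n] points, with
    [N] large.  Deleting loops from the chain of cubes, a ball meets few of them,
    and with [sigma = s (n - 1)] one gets
    [|u(x) - average| <= C sum_j m_j (r_j + |x - x_j|)^(-sigma)].

    Weak type: if every ball centred at [x] has mass at most [tau r^n], Hedberg's
    dyadic splitting bounds the potential by
    [C (sum_j m_j)^(1 - sigma/n) tau^(sigma/n)].  The exceptional points are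
    covered through maximal heavy dyadic cubes, which are disjoint, so their
    content is at most [C tau^(-delta/n) sum_j m_j^(delta/n)].  Two points outside
    the exceptional set are chained to the same final cube, so [b] can be the value
    of [u] at any of them. *)

Set Implicit Arguments. Unset Strict Implicit. Unset Printing Implicit Defensive.

(** * Norms and John curves *)

Section Norms.
Context {R : realType} {n : nat}.
Implicit Types (v x y z : 'rV[R]_n) (r : R).

Lemma coord_le_norm v i : `|v ord0 i| <= `|v|.
Proof.
rewrite [leRHS]/Num.norm /= mx_normrE.
by apply: (@le_bigmax _ _ _ _ (fun i : 'I_1 * 'I_n => `|v i.1 i.2|) (ord0, i)).
Qed.

Lemma norm_le_coord v r : 0 <= r -> (forall i, `|v ord0 i| <= r) -> `|v| <= r.
Proof.
move=> r0 h; rewrite [leLHS]/Num.norm /= mx_normrE.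
by apply/bigmax_leP; split=> // -[j i] _ /=; rewrite (ord1 j).
Qed.

Lemma norm_le_enorm v : `|v| <= enorm v.
Proof.
apply: norm_le_coord => [|i]; first exact: sqrtr_ge0.
rewrite -sqrtr_sqr ler_sqrt; last by apply: sumr_ge0 => j _; rewrite sqr_ge0.
by rewrite (bigD1 i) //= lerDl sumr_ge0 // => j _; rewrite sqr_ge0.
Qed.

Lemma enorm_le_norm v : enorm v <= n%:R * `|v|.
Proof.
have nv0 : 0 <= n%:R * `|v| by rewrite mulr_ge0.
rewrite -(ger0_norm nv0) -sqrtr_sqr ler_sqrt ?sqr_ge0//.
apply: (@le_trans _ _ (\sum_(i < n) `|v| ^+ 2)).
  apply: ler_sum => i _; rewrite -(real_normK (num_real (v ord0 i))).
  by rewrite lerXn2r ?nnegrE ?normr_ge0 // coord_le_norm.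
rewrite sumr_const card_ord exprMn -[leLHS]mulr_natl.
rewrite ler_wpM2r ?sqr_ge0// -natrX ler_nat.
by case: (n) => // m; rewrite leq_pmulr.
Qed.

End Norms.

Section John.
Context {R : realType} {n : nat}.
Implicit Types (Om : set 'rV[R]_n) (x y z : 'rV[R]_n).

Lemma dist_bdry_le Om y z : bdry Om z -> dist_bdry Om y <= enorm (y - z).
Proof.
move=> bz; apply: ge_inf; last by exists z.
by exists 0 => _ [w _ <-]; exact: sqrtr_ge0.
Qed.

Lemma enormZ (a : R) x : 0 <= a -> enorm (a *: x) = a * enorm x.
Proof.
move=> a0; rewrite /enorm -[in RHS](ger0_norm a0) -sqrtr_sqr -sqrtrM ?sqr_ge0//.
by congr Num.sqrt; rewrite mulr_sumr; apply: eq_bigr => i _; rewrite mxE exprMn.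
Qed.

(** The segment from [y] to a point [z] of the ball is connected, and its trace on [Om] is
    relatively open. The trace is also relatively closed, since a boundary point on the segment
    would be closer to [y] than [r]. So the whole segment lies in [Om]. *)
Lemma eball_dist_bdry_sub Om y r : open Om -> Om y -> r <= dist_bdry Om y ->
  eball y r `<=` Om.
Proof.
move=> oOm Oy rd z yz.
pose f (a : R) : 'rV[R]_n := y + a *: (z - y).
have cf : continuous f.
  move=> a; apply: cvgD; first exact: cvg_cst.
  by apply: cvgZr_tmp; exact: cvg_id.
pose A := f @` `[0, 1].
have cA : connected A.
  apply: connected_continuous_connected; first exact: segment_connected.
  exact: continuous_subspaceT.
have AI : A `&` Om = A `&` closure Om.
  apply/seteqP; split=> w [Aw Ow]; split=> //; first exact: subset_closure.
  apply: contrapT => nOw; move: Aw => [a]; rewrite /= in_itv /= => /andP[a0 a1] fa.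
  have : dist_bdry Om y <= enorm (y - w) by apply: dist_bdry_le.
  apply/negP; rewrite -ltNge; apply: lt_le_trans rd.
  apply: le_lt_trans yz.
  rewrite -fa /f opprD addNKr -scalerN opprB -opprB scalerN.
  have enormN (v : 'rV[R]_n) : enorm (- v) = enorm v.
    by rewrite /enorm; congr Num.sqrt; apply: eq_bigr => i _; rewrite mxE sqrrN.
  by rewrite enormN enormZ// ler_piMl// sqrtr_ge0.
have /seteqP[_ /(_ z) Az] : A `&` Om = A.
  apply: cA.
  - by exists y; split=> //; exists 0; rewrite /f ?scale0r ?addr0//= in_itv /= lexx ler01.
  - by exists Om => //; rewrite setIC.
  - by exists (closure Om) => //; exact: closed_closure.
suff /Az[] : A z by [].
exists 1; first by rewrite /= in_itv /= lexx ler01.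
by rewrite /f scale1r addrC subrK.
Qed.

(* The John curve is prolonged by the constant [x0], so that all curves are
   parametrised by the same interval [0, L]. *)
Lemma john_curves Om (s : R) : 1 <= s -> s_john s Om ->
  exists c0 L : R, exists x0 : 'rV[R]_n, [/\ 0 < c0, 0 < L, Om x0 &
  forall x, Om x -> exists gam : R -> 'rV[R]_n, [/\ gam 0 = x, gam L = x0,
    forall t t', 0 <= t -> t <= t' -> t' <= L -> `|gam t' - gam t| <= t' - t &
    forall t, 0 <= t <= L -> forall z, `|z - gam t| < c0 * t `^ s -> Om z]].
Proof.
move=> s1 [[oOm [_ [_ _]]] [cJ [CJ [cJ0 [CJ0 [x0 [Ox0 H]]]]]]].
have [e e0 xe] : exists2 e : R, 0 < e & forall z, `|z - x0| < e -> Om z.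
  have /nbhs_ballP[e /= e0 xe] := open_nbhs_nbhs (conj oOm Ox0).
  by exists e => // z ze; apply: xe; rewrite -ball_normE /= distrC.
have n0 : 0 <= n%:R :> R by [].
have s0 : 0 <= s by exact: le_trans s1.
set Ls := CJ `^ s.
have Ls0 : 0 < Ls by exact: powR_gt0.
(* The first entry pays for passing from the sup norm to the Euclidean one. The second keeps c0 t^s
   below the radius [e] of a ball around [x0] inside [Om], for the times at which the prolonged
   curve rests at [x0]. *)
pose c0 := Num.min (cJ / (n%:R + 1)) (e / Ls).
have c00 : 0 < c0 by rewrite lt_min !divr_gt0// ltr_wpDl.
exists c0, CJ, x0; split=> // x Ox.
have [g [l [[l0 gl] [g0 [gl0 [lC [gO gd]]]]]]] := H x Ox.
have minl t : 0 <= t -> 0 <= Num.min t l <= l.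
  by move=> t0; rewrite le_min t0 l0 /= ge_min lexx orbT.
exists (fun t => g (Num.min t l)); split.
- by rewrite min_l.
- by rewrite min_r.
- move=> t t' t0 tt' t'L.
  have /andP[ml0 ml1] := minl t t0; have /andP[ml0' ml1'] := minl t' (le_trans t0 tt').
  have mm : Num.min t l <= Num.min t' l.
    by rewrite le_min !ge_min tt' lexx orbT.
  have lip : Num.min t' l - Num.min t l <= t' - t.
    rewrite /Num.min; case: ltP => ?; case: ltP => ?; lra.
  apply: le_trans lip; apply: (le_trans (norm_le_enorm _)).
  rewrite -lee_fin -(gl _ _ ml0 mm ml1').
  (* The chord is bounded by the arc length through the partition that has only the two end
     points. *)
  apply: ereal_sup_ubound; exists 1%N, (fun i => if i == 0%N then Num.min t l else Num.min t' l).
  by split=> //; split=> //; split; [case|rewrite big_ord1].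
- move=> t /andP[t0 tL] z.
  have [tl|lt] := leP t l; last first.
    rewrite gl0 => zx; apply: xe; apply: (lt_le_trans zx).
    apply: (@le_trans _ _ (e / Ls * Ls)); last by rewrite divfK// gt_eqF.
    apply: ler_pM; rewrite ?(ltW c00) ?powR_ge0// /c0.
      by rewrite ge_min lexx orbT.
    by rewrite ge0_ler_powR// nnegrE// ltW.
  move=> zx.
  have t0l : 0 <= t <= l by rewrite t0 tl.
  apply: (eball_dist_bdry_sub oOm (gO t t0l) (gd t t0l)).
  apply: (le_lt_trans (enorm_le_norm _)).
  (* At time 0 the radius c0 0^s vanishes, so the strict inequality on [z] is contradictory; for t >
     0 the factor n / (n + 1) gives the strict bound. *)
  have [t00|tn0] := eqVneq t 0.
    have sn0 : s != 0 by rewrite gt_eqF// (lt_le_trans _ s1).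
    by move: zx; rewrite t00 (powR0 sn0) mulr0 ltNge normr_ge0.
  have ts : 0 < t `^ s by rewrite powR_gt0// lt_neqAle eq_sym tn0.
  apply: (@le_lt_trans _ _ (n%:R * (cJ / (n%:R + 1) * t `^ s))).
    apply: ler_wpM2l => //; apply: (le_trans (ltW zx)).
    by rewrite ler_pM2r// ge_min lexx.
  rewrite mulrA ltr_pM2r// mulrA ltr_pdivrMr ?ltr_wpDl//.
  by rewrite mulrDr mulr1 [_ * cJ]mulrC ltrDl.
Qed.

End John.

(** * Lattice cells and real powers *)

Section Cells.
Context {R : realType} {n : nat}.
Implicit Types (x y z : 'rV[R]_n) (h : R) (p : 'rV[int]_n).

Definition cell h x : 'rV[int]_n := \row_i Num.floor (x ord0 i / h).
Definition corner h p : 'rV[R]_n := \row_i (h * (p ord0 i)%:~R).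

Lemma cellP h x i : 0 < h ->
  corner h (cell h x) ord0 i <= x ord0 i < corner h (cell h x) ord0 i + h.
Proof.
move=> h0; rewrite !mxE; set a := x ord0 i.
have := floor_le (a / h); have := floorD1_gt (a / h); rewrite intrD1.
set f := (_%:~R) => lt le.
have ea : a = h * (a / h) by rewrite mulrC divfK// gt_eqF.
apply/andP; split; first by rewrite [leRHS]ea ler_pM2l.
by rewrite [ltLHS]ea -[X in _ + X]mulr1 -mulrDr ltr_pM2l.
Qed.

Lemma cell_corner_dist h x : 0 < h -> `|x - corner h (cell h x)| <= h.
Proof.
move=> h0; apply: norm_le_coord => [|i]; first exact: ltW.
have /andP[a b] := cellP x i h0; rewrite mxE [X in _ + X]mxE.
rewrite ger0_norm; lra.
Qed.

Lemma cell_double h x y : cell h x = cell h y -> cell (2 * h) x = cell (2 * h) y.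
Proof.
move=> /rowP e; apply/rowP => i; move: (e i); rewrite !mxE => {}e.
have half z : z ord0 i / h = 2 * (z ord0 i / (2 * h)).
  by rewrite invfM mulrCA [2 * _]mulrA mulfV ?pnatr_eq0// mul1r.
move: e; rewrite !half; set a := _ / _; set b := _ / _.
have le (a' b' : R) : Num.floor (2 * a') = Num.floor (2 * b') :> int ->
    (Num.floor a' <= Num.floor b')%R.
  move=> e; rewrite leNgt; apply/negP => lt.
  suff : (Num.floor (2 * b') < Num.floor (2 * a'))%R by rewrite e ltxx.
  have h1 : (Num.floor (2 * b') < 2 * Num.floor a')%R.
    by rewrite floor_lt_int intrM ltr_pM2l// -floor_lt_int.
  by apply: (lt_le_trans h1); rewrite floor_ge_int intrM ler_pM2l// floor_le.
by move=> e; apply/eqP; rewrite eq_le !le.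
Qed.

Lemma cell_near h x y i : 0 < h -> `|x - y| <= h ->
  (cell h x ord0 i - 1 <= cell h y ord0 i <= cell h x ord0 i + 1)%R.
Proof.
move=> h0 xy; rewrite !mxE; set a := x ord0 i; set b := y ord0 i.
have : `|a - b| <= h by apply: le_trans xy; have := coord_le_norm (x - y) i; rewrite !mxE.
rewrite ler_norml => /andP[u v].
have [u' v'] : b / h <= a / h + 1 /\ a / h - 1 <= b / h.
  split; first by rewrite ler_pdivrMr// mulrDl divfK ?gt_eqF//; lra.
  by rewrite lerBlDr ler_pdivrMr// mulrDl divfK ?gt_eqF//; lra.
have := floor_le (a / h); have := floorD1_gt (a / h); rewrite intrD1.
have := floor_le (b / h); have := floorD1_gt (b / h); rewrite intrD1.
move=> ? ? ? ?; apply/andP; split.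
- by rewrite floor_ge_int intrB; lra.
- by rewrite -ltzD1 floor_lt_int !intrD1; lra.
Qed.

End Cells.

Section PowR.
Context {R : realType}.
Implicit Types (x y q : R).

(** Each ratio z / (x + y) lies in [0, 1], so it is at most its own power with exponent [q]; the two
    ratios add up to 1. *)
Lemma powR_subadd x y q : 0 <= x -> 0 <= y -> 0 < q -> q <= 1 ->
  (x + y) `^ q <= x `^ q + y `^ q.
Proof.
move=> x0 y0 q0 q1.
have [s0|] := ltP 0 (x + y); last first.
  move=> le; have -> : x + y = 0 by lra.
  by rewrite powR0 ?gt_eqF// addr_ge0// powR_ge0.
have part z : 0 <= z -> z <= x + y -> z / (x + y) * (x + y) `^ q <= z `^ q.
  move=> z0 zs; rewrite -[in leRHS](divfK (lt0r_neq0 s0) z).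
  have zs0 : 0 <= z / (x + y) by rewrite divr_ge0// ltW.
  rewrite powRM// ?(ltW s0)// ler_wpM2r ?powR_ge0//.
  have [->|zn0] := eqVneq z 0; first by rewrite mul0r powR_ge0.
  have zs1 : z / (x + y) <= 1 by rewrite ler_pdivrMr ?mul1r.
  rewrite -[leLHS]powRr1// ger_powR// zs1 andbT divr_gt0// lt_neqAle eq_sym zn0//.
rewrite -[leLHS]mul1r -(mulfV (lt0r_neq0 s0)) 2!mulrDl.
by apply: lerD; apply: part => //; lra.
Qed.

Lemma powR_sum_le (I : Type) (s : seq I) (P : pred I) (F : I -> R) q :
  (forall i, 0 <= F i) -> 0 < q -> q <= 1 ->
  (\sum_(i <- s | P i) F i) `^ q <= \sum_(i <- s | P i) F i `^ q.
Proof.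
move=> F0 q0 q1.
suff [] : 0 <= \sum_(i <- s | P i) F i /\
  (\sum_(i <- s | P i) F i) `^ q <= \sum_(i <- s | P i) F i `^ q by [].
elim/big_rec2: _ => [|i y1 y2 _ [y10 IH]]; first by rewrite powR0 ?gt_eqF.
split; first exact: addr_ge0.
by apply: (le_trans (powR_subadd _ _ _ _)) => //; rewrite lerD2l.
Qed.

Lemma sum_unique_le1 (N : nat) (P : pred nat) :
  (forall i j, P i -> P j -> i = j) -> \sum_(0 <= i < N) (P i)%:R <= 1 :> R.
Proof.
move=> uP; elim: N => [|N IH]; first by rewrite big_geq.
rewrite big_nat_recr//=; case: (boolP (P N)) => PN; last by rewrite addr0.
rewrite big_nat big1 ?add0r// => i /andP[_ iN].
case: (boolP (P i)) => // Pi; have := uP _ _ Pi PN => e.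
by rewrite e ltnn in iN.
Qed.

End PowR.

(** * Content of the points of high density *)

Section Content.
Context {R : realType} {n : nat}.
Implicit Types (E F : set 'rV[R]_n).

Lemma hcontent_le E (d B : R) (c : nat -> 'rV[R]_n) (r : nat -> R) :
  (forall i, 0 <= r i) -> E `<=` \bigcup_i eball (c i) (r i) ->
  (forall N, \sum_(0 <= i < N) r i `^ d <= B) -> (hcontent d E <= B%:E)%E.
Proof.
move=> r0 Ec rB; apply: (@le_trans _ _ (\sum_(0 <= i <oo) ((r i) `^ d)%:E)%E).
  by apply: ereal_inf_lbound; exists r => //; exists c.
apply: lime_le.
  by apply: is_cvg_nneseries => i _ _; rewrite lee_fin powR_ge0.
by apply: nearW => N; rewrite sumEFin lee_fin.
Qed.

Lemma hcontent_mono E F (d : R) : E `<=` F -> (hcontent d E <= hcontent d F)%E.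
Proof.
move=> EF; apply: ereal_inf_le_tmp => _ [r [c [r0 Fc]] <-].
by exists r => //; exists c; split=> //; exact: subset_trans Fc.
Qed.

Lemma hcontent_ge0 E (d : R) : (0 <= hcontent d E)%E.
Proof.
apply: le_ereal_inf_tmp => _ [r [c [r0 Fc]] <-].
by apply: nneseries_ge0 => i _ _; rewrite lee_fin powR_ge0.
Qed.

Lemma hcontent_covering E (d B : R) : (hcontent d E < B%:E)%E ->
  exists (c : nat -> 'rV[R]_n) (r : nat -> R), [/\ forall i, 0 <= r i,
    E `<=` \bigcup_i eball (c i) (r i) &
    forall N, \sum_(0 <= i < N) r i `^ d <= B].
Proof.
move=> /ereal_inf_lt[_ [r [c [r0 Ec]] <-] rB]; exists c, r; split=> // N.
rewrite -lee_fin -sumEFin; apply: le_trans (ltW rB).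
by apply: nneseries_lim_ge => i _ _; rewrite lee_fin powR_ge0.
Qed.

End Content.

(** * Maximal heavy dyadic cells *)

Section HeavyCells.
Context {R : realType} {n : nat}.
Variables (xs : nat -> 'rV[R]_n) (ms : nat -> R) (tau M q A : R).
Hypotheses (ms0 : forall j, 0 <= ms j) (tau0 : 0 < tau) (M0 : 0 < M).
Hypotheses (q0 : 0 < q) (q1 : q <= 1) (n0 : (0 < n)%N).
Hypothesis sumM : forall m, \sum_(0 <= j < m) ms j <= M.
Hypothesis sumA : forall m, \sum_(0 <= j < m) ms j `^ q <= A.

(** Superlevel set at height [tau] of the maximal function of the point masses [ms j] at [xs j].
    Finite partial sums replace the series, so no convergence question arises. *)
Definition dense_set : set 'rV[R]_n := [set x | exists r m, 0 < r /\
  tau * r ^+ n < \sum_(0 <= j < m | `|x - xs j| <= r) ms j].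

(** The scale with tau h0^n = M: a ball of larger radius cannot be too dense, since the total mass
    is at most [M]. *)
Let h0 : R := (M / tau) `^ (n%:R^-1).
Let h (k : nat) : R := h0 / 2 ^+ k.
(** The loss 6^n is 3^n, for the cells that a ball can meet, times 2^n, for rounding its radius up
    to a dyadic scale. *)
Let tau' := tau / 6 ^+ n.

Let h0_gt0 : 0 < h0. Proof. by rewrite powR_gt0// divr_gt0. Qed.
Let h_gt0 k : 0 < h k. Proof. by rewrite divr_gt0// exprn_gt0. Qed.
Let hS k : h k = 2 * h k.+1.
Proof.
by rewrite /h exprS invfM mulrCA [2 * (2^-1 * _)]mulrA mulfV ?pnatr_eq0// mul1r.
Qed.
Let h_le k k' : (k <= k')%N -> h k' <= h k.
Proof.
move=> kk; rewrite ler_pM2l// lef_pV2 ?posrE ?exprn_gt0//.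
by rewrite ler_eXn2l// ltr1n.
Qed.

Let cell_coarsen k k' (x y : 'rV[R]_n) : (k <= k')%N -> cell (h k') x = cell (h k') y ->
  cell (h k) x = cell (h k) y.
Proof.
move=> /subnK <-; elim: (k' - k)%N => [//|i IH]; rewrite addSn => e.
by apply: IH; rewrite hS; exact: cell_double.
Qed.

Let mass k (p : 'rV[int]_n) m := \sum_(0 <= j < m | cell (h k) (xs j) == p) ms j.

Let mass_mono k p m m' : (m <= m')%N -> mass k p m <= mass k p m'.
Proof.
move=> mm; rewrite /mass [leRHS](big_cat_nat (leq0n m) mm)//= lerDl.
by apply: sumr_ge0.
Qed.

Let heavy k p := exists m, tau' * h k ^+ n < mass k p m.

(** The maximal heavy cells. Maximality is tested along the coarser cells of some [xs j] in the
    cell; by nesting the choice of [j] is immaterial. *)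
Let sel k p := heavy k p /\ exists j, cell (h k) (xs j) = p /\
  forall k', (k' < k)%N -> ~ heavy k' (cell (h k') (xs j)).

(** Disjointness of the maximal cells, as seen by the masses: if two of them contained [xs j], the
    coarser one would be a heavy ancestor of the finer one. *)
Let sel_uniq k p k' p' j : sel k p -> sel k' p' ->
  cell (h k) (xs j) = p -> cell (h k') (xs j) = p' -> (k, p) = (k', p').
Proof.
wlog kk : k k' p p' / (k <= k')%N.
  move=> H s s' e e'; have [kk|kk] := leqP k k'; first exact: H.
  by apply/esym; apply: H => //; exact: ltnW.
move=> [hv _] [_ [i [ei ni]]] e e'.
move: kk; rewrite leq_eqVlt => /orP[/eqP kk|kk].
  by rewrite -e -e' kk.
exfalso; apply: (ni _ kk).
have -> : cell (h k) (xs i) = cell (h k) (xs j).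
  by apply: cell_coarsen (ltnW kk) _; rewrite ei.
by rewrite e.
Qed.

(** Choose the scale with h (k+1) < r <= h k. The ball meets at most 3^n cells of that scale, so one
    of them carries at least the fraction 3^(-n) of its mass, and a cell of positive mass contains
    some [xs j]. *)
Let heavy_near (x : 'rV[R]_n) r m : 0 < r -> tau * r ^+ n < \sum_(0 <= j < m | `|x - xs j| <= r) ms j ->
  exists k j, [/\ `|x - xs j| <= 2 * h k & heavy k (cell (h k) (xs j))].
Proof.
move=> r0 big.
have rh0 : r <= h 0%N.
  have n0R : n%:R != 0 :> R by rewrite pnatr_eq0 -lt0n.
  have -> : r = (r ^+ n) `^ n%:R^-1.
    by rewrite -powR_mulrn ?(ltW r0)// -powRrM mulfV// powRr1// ltW.
  rewrite /h expr0 divr1 /h0 ge0_ler_powR ?invr_ge0// ?nnegrE ?exprn_ge0 ?(ltW r0)//.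
    by rewrite divr_ge0// ltW.
  rewrite ler_pdivlMr// mulrC.
  apply: (le_trans (ltW big)); apply: le_trans (sumM m).
  by rewrite big_mkcond/=; apply: ler_sum => i _; case: ifP.
have [k rk rk1] : exists2 k, r <= h k & h k.+1 < r.
  have ex : exists k, h k < r.
    have := @archi_boundP _ (h0 / r); rewrite divr_ge0 ?(ltW r0) ?(ltW h0_gt0)//.
    move=> /(_ isT); set K := Num.bound _; rewrite ltr_pdivrMr// => hK.
    exists K; rewrite /h ltr_pdivrMr ?exprn_gt0//; apply: (lt_le_trans hK).
    rewrite mulrC ler_pM2l// -natrX ler_nat; exact/ltnW/ltn_expl.
  case: (ex_minnP ex) => -[|k] hk mink; first by move: hk; rewrite ltNge rh0.
  exists k => //; rewrite leNgt; apply/negP => /mink.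
  by rewrite ltnn.
(* The cell of [x] and its neighbours: the offset e i - 1 runs over -1, 0, 1 in each coordinate. *)
pose P (e : {ffun 'I_n -> 'I_3}) : 'rV[int]_n := \row_i (cell (h k) x ord0 i + (e i)%:Z - 1).
have cov j : `|x - xs j| <= r -> exists e, cell (h k) (xs j) = P e.
  move=> xr; exists [ffun i => inord (absz (cell (h k) (xs j) ord0 i - cell (h k) x ord0 i + 1)%R)].
  apply/rowP => i; rewrite [RHS]mxE ffunE.
  have /andP[a b] := cell_near i (h_gt0 k) (le_trans xr rk).
  set u := cell _ (xs j) _ _ in a b *; set v := cell _ x _ _ in a b *.
  have w0 : (0 <= u - v + 1)%R by lia.
  have w1 : (absz (u - v + 1)%R < 3)%N by lia.
  by rewrite inordK// gez0_abs//; lia.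
have [e he] : exists e, tau / 3 ^+ n * r ^+ n < mass k (P e) m.
  apply: contrapT => /forallNP H; move: big; apply/negP; rewrite -leNgt.
  apply: (@le_trans _ _ (\sum_(e : {ffun 'I_n -> 'I_3}) mass k (P e) m)).
    rewrite /mass; under [leRHS]eq_bigr => e _ do rewrite big_mkcond.
    rewrite [leRHS]exchange_big /= [leLHS]big_mkcond; apply: ler_sum => j _.
    case: ifPn => [/cov[e He]|_]; last by apply: sumr_ge0 => e _; case: ifP.
    rewrite (bigD1 e)//= He eqxx lerDl.
    by apply: sumr_ge0 => e' _; case: ifP.
  apply: (@le_trans _ _ (\sum_(e : {ffun 'I_n -> 'I_3}) tau / 3 ^+ n * r ^+ n)).
    by apply: ler_sum => e _; rewrite leNgt; exact/negP/H.
  rewrite sumr_const card_ffun !card_ord -[leLHS]mulr_natl natrX.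
  by rewrite mulrCA mulrA divfK ?expf_neq0 ?pnatr_eq0.
have [j ej] : exists j, cell (h k) (xs j) = P e.
  apply: contrapT => /forallNP H; move: he; apply/negP; rewrite -leNgt.
  rewrite /mass big1 ?mulr_ge0 ?divr_ge0 ?exprn_ge0 ?(ltW r0) ?(ltW tau0)//.
  by move=> j /eqP /H.
exists k, j; split.
  apply: norm_le_coord => [|i]; first by rewrite mulr_ge0// ltW.
  have /andP[] := cellP x i (h_gt0 k); have /andP[] := cellP (xs j) i (h_gt0 k).
  rewrite ej !mxE !(intrD, intrN) mulrBr mulrDr !mulr1.
  set u := _ * _%:~R; set w := _ * _%:~R => a b c d.
  have [w0 w2] : 0 <= w /\ w <= 2 * h k.
    rewrite /w -pmulrn; split; first by rewrite mulr_ge0// ltW.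
    by rewrite mulrC ler_pM2r// ler_nat -ltnS.
  by rewrite ler_norml; apply/andP; split; lra.
(* With 6^n = 3^n 2^n, the factor 2^(-n) turns [h k] into h (k+1), which is below [r]. *)
exists m; rewrite ej; apply: le_lt_trans he.
rewrite /tau' (_ : 6 = 3 * 2 :> R); last by rewrite -natrM.
rewrite exprMn invfM -!mulrA ler_pM2l// ler_pM2l ?invr_gt0 ?exprn_gt0//.
rewrite -exprVn -exprMn.
have hk : 2^-1 * h k = h k.+1 by rewrite hS mulKf ?pnatr_eq0.
rewrite hk; apply: lerXn2r; rewrite ?nnegrE; [exact/ltW/h_gt0|exact: ltW|exact: ltW].
Qed.

Let heavy_sel k j : heavy k (cell (h k) (xs j)) ->
  exists2 k', (k' <= k)%N & sel k' (cell (h k') (xs j)).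
Proof.
move=> hv; have ex : exists k, `[< heavy k (cell (h k) (xs j)) >] by exists k; apply/asboolP.
case: (ex_minnP ex) => k' /asboolP hk mink.
exists k'; first by apply: mink; apply/asboolP.
split=> //; exists j; split=> // k'' lt /asboolP /mink.
by rewrite leqNgt lt.
Qed.

(** The maximal heavy cells, enlarged to balls, cover the set. Heaviness bounds the side to the
    power [n] by 6^n / tau times the mass of the cell. Raising to the power q <= 1 and using
    subadditivity leaves a sum of the [ms j] to the power [q], where each [j] occurs at most
    once. *)
Lemma dense_set_content :
  (hcontent (q * n%:R) dense_set <= ((24 * n%:R) `^ (q * n%:R) * tau `^ (- q) * A)%:E)%E.
Proof.
pose idx i : option (nat * 'rV[int]_n) :=
  if pickle_inv i is Some kp then if `[< sel kp.1 kp.2 >] then Some kp else None else None.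
have idx_sel i kp : idx i = Some kp -> sel kp.1 kp.2 /\ pickle kp = i.
  rewrite /idx; have := @pickle_invK (nat * 'rV[int]_n)%type i; case: (pickle_inv i) => //= kp' <-.
  by case: asboolP => // s [<-].
have sel_idx kp : sel kp.1 kp.2 -> exists i, idx i = Some kp.
  by move=> s; exists (pickle kp); rewrite /idx pickleK_inv asboolT.
(* A code of no selected cell receives radius 0, hence an empty ball and a zero term. Otherwise a
   covered point is at sup-distance below 2h + 2h from the corner, and [n] compares the norms; 4
   here and 6 from heaviness give the constant 24. *)
pose r i := if idx i is Some kp then 4 * n%:R * h kp.1 else 0.
pose c i := if idx i is Some kp then corner (h kp.1) kp.2 else 0.
have r0 i : 0 <= r i.
  by rewrite /r; case: (idx i) => // kp; rewrite !mulr_ge0// ltW.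
apply: (@hcontent_le _ _ _ _ _ c r) => //.
  move=> x [rr [m [rr0 /(heavy_near rr0)[k [j [xj /heavy_sel[k' kk s]]]]]]].
  have [i ii] := sel_idx (k', _) s; exists i => //; rewrite /eball /= /c /r ii /=.
  apply: (le_lt_trans (enorm_le_norm _)).
  rewrite -mulrA mulrCA ltr_pM2l ?ltr0n//.
  apply: (@le_lt_trans _ _ (2 * h k + h k')).
    rewrite (_ : x - _ = (x - xs j) + (xs j - corner (h k') (cell (h k') (xs j)))); last first.
      by rewrite addrA subrK.
    by apply: (le_trans (ler_normD _ _)); rewrite lerD// cell_corner_dist.
  by have := h_le kk; have := h_gt0 k'; lra.
move=> N.
(* Each heavy cell is detected by a finite partial sum; one truncation [m] serves the finitely many
   cells with i < N. *)
have [m Hm] : exists m, forall i kp, (i < N)%N -> idx i = Some kp ->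
    tau' * h kp.1 ^+ n < mass kp.1 kp.2 m.
  elim: (N) => [|N' [m IH]]; first by exists 0%N.
  have [m' Hm'] : exists m', forall kp, idx N' = Some kp -> tau' * h kp.1 ^+ n < mass kp.1 kp.2 m'.
    case e : (idx N') => [kp|]; last by exists 0%N.
    by have [[[m' h'] _] _] := idx_sel _ _ e; exists m' => _ [<-].
  exists (maxn m m') => i kp; rewrite ltnS leq_eqVlt => /orP[/eqP ->|iN] e.
    by apply: (lt_le_trans (Hm' _ e)); apply: mass_mono; rewrite leq_maxr.
  by apply: (lt_le_trans (IH _ _ iN e)); apply: mass_mono; rewrite leq_maxl.
pose b i j := if idx i is Some kp then cell (h kp.1) (xs j) == kp.2 else false.
set C := _ `^ _ * _.
have C0 : 0 <= C by rewrite mulr_ge0 ?powR_ge0.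
have term i : (i < N)%N -> r i `^ (q * n%:R) <= \sum_(0 <= j < m) C * (ms j `^ q * (b i j)%:R).
  move=> iN; rewrite /r /b; case e : (idx i) => [kp|]; last first.
    rewrite powR0; last by rewrite mulf_neq0 ?gt_eqF ?ltr0n.
    by apply: sumr_ge0 => j _; rewrite mulr0 mulr0.
  have /ltW hm := Hm _ _ iN e.
  have hn : h kp.1 ^+ n <= 6 ^+ n / tau * mass kp.1 kp.2 m.
    by rewrite mulrC -invf_div -/tau' ler_pdivlMr ?divr_gt0 ?exprn_gt0// mulrC.
  have mass0 : 0 <= mass kp.1 kp.2 m by apply: sumr_ge0.
  rewrite -mulr_sumr.
  rewrite (powRM _ _ (ltW (h_gt0 kp.1))) ?mulr_ge0//.
  rewrite [h kp.1 `^ _](_ : _ = (h kp.1 ^+ n) `^ q); last first.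
    by rewrite mulrC powRrM powR_mulrn// ltW.
  apply: (@le_trans _ _ ((4 * n%:R) `^ (q * n%:R) * (6 ^+ n / tau * mass kp.1 kp.2 m) `^ q)).
    rewrite ler_wpM2l ?powR_ge0// ge0_ler_powR ?nnegrE ?(ltW q0)//.
      by rewrite exprn_ge0// ltW.
    by rewrite !mulr_ge0 ?exprn_ge0 ?invr_ge0 ?(ltW tau0).
  rewrite (powRM _ _ mass0); last by rewrite divr_ge0 ?exprn_ge0 ?(ltW tau0).
  rewrite [(6 ^+ n / tau) `^ q]powRM ?exprn_ge0 ?invr_ge0 ?(ltW tau0)//.
  rewrite -(powR_inv1 (ltW tau0)) -powRrM mulN1r -[6 ^+ n]powR_mulrn// -powRrM.
  rewrite [n%:R * q]mulrC 2!mulrA -powRM ?mulr_ge0//.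
  rewrite (_ : 4 * n%:R * 6 = 24 * n%:R); last by ring.
  rewrite -/C ler_wpM2l//.
  apply: (le_trans (powR_sum_le _ _ ms0 q0 q1)).
  rewrite big_mkcond; apply: ler_sum => j _.
  by case: ifP => _; rewrite ?mulr1 ?mulr0.
apply: (@le_trans _ _ (\sum_(0 <= i < N) \sum_(0 <= j < m) C * (ms j `^ q * (b i j)%:R))).
  by rewrite big_nat [leRHS]big_nat; apply: ler_sum => i /andP[_ iN]; exact: term.
rewrite exchange_big /=; apply: (@le_trans _ _ (\sum_(0 <= j < m) C * ms j `^ q)).
  apply: ler_sum => j _; rewrite -mulr_sumr -mulr_sumr ler_wpM2l//.
  rewrite ler_piMr ?powR_ge0//; apply: (@sum_unique_le1 _ _ (b^~ j)).
  move=> i i'; rewrite /b; case e : (idx i) => [[k p]|//]; case e' : (idx i') => [[k' p']|//] /=.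
  move=> /eqP ep /eqP ep'.
  have [s pi] := idx_sel _ _ e; have [s' pi'] := idx_sel _ _ e'.
  by rewrite -pi -pi'; congr pickle; exact: (sel_uniq s s' ep ep').
by rewrite -mulr_sumr ler_wpM2l.
Qed.

End HeavyCells.

(** * Grid averages along moving cubes *)

Section LineDerivative.
Context {R : realType} {V : normedModType R}.

(** A chain rule asking only for derivability of [u] in the direction [e], so that partial
    derivatives suffice when grid points move parallel to an axis. *)
Lemma is_derive_line (u : V -> R) (a e : V) (d x : R) :
  derivable u (a + (x * d) *: e) e ->
  is_derive x 1 (fun t => u (a + (t * d) *: e)) (d * 'D_e u (a + (x * d) *: e)).
Proof.
move=> du; pose phi (t : R) := u (a + t *: e).
have eq t : (fun h : R => h^-1 *: ((phi \o shift t) (h *: (1 : R)) - phi t)) =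
    (fun h : R => h^-1 *: ((u \o shift (a + t *: e)) (h *: e) - u (a + t *: e))).
  apply/funext => h; rewrite /phi /=.
  by rewrite [h *: (1 : R)]mulr1 scalerDl addrCA.
have dphi : is_derive (x * d) 1 phi ('D_e u (a + (x * d) *: e)).
  split; first by rewrite /derivable eq.
  by rewrite /derive eq.
have dl : is_derive x 1 (fun t : R => t * d) d.
  have : is_derive x 1 (fun t : R => d *: t) (d *: (1 : R)) by apply: is_deriveZ.
  by rewrite [d *: (1 : R)]mulr1; congr is_derive; apply/funext => t; rewrite mulrC.
have := @is_derive1_comp _ phi (fun t => t * d) x _ _ dphi dl.
by rewrite mulrC.
Qed.

Lemma is_derive_bigsum (I : Type) (s : seq I) (f : I -> R -> R) (df : I -> R) (x : R) :
  (forall i, is_derive x 1 (f i) (df i)) ->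
  is_derive x 1 (fun t => \sum_(i <- s) f i t) (\sum_(i <- s) df i).
Proof.
move=> H; elim: s => [|i s IH].
  rewrite big_nil; have -> : (fun t : R => \sum_(i <- [::]) f i t) = cst 0.
    by apply/funext => t; rewrite big_nil.
  exact: is_derive_cst.
rewrite big_cons; have -> : (fun t => \sum_(j <- i :: s) f j t) =
    f i + (fun t => \sum_(j <- s) f j t).
  by apply/funext => t; rewrite big_cons.
exact: is_deriveD.
Qed.

End LineDerivative.

Section GridAverage.
Context {R : realType} {n : nat}.
Implicit Types (c w z : 'rV[R]_n) (f : 'rV[R]_n -> R).

(** Nodes of a grid on the box with corner [c] and side vector [w]. The sides may differ, because
    boxes are deformed one coordinate at a time. *)
Definition grid_pt (N : nat) c w (y : {ffun 'I_n -> 'I_N}) : 'rV[R]_n :=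
  \row_i (c ord0 i + w ord0 i * ((y i)%:R / N%:R)).

Definition grid_avg (N : nat) c w f : R :=
  (N%:R ^+ n)^-1 * \sum_(y : {ffun 'I_n -> 'I_N}) f (grid_pt c w y).

Definition in_cube z (r : R) c w := forall i,
  [/\ 0 <= w ord0 i, z ord0 i - r <= c ord0 i &
      c ord0 i + w ord0 i <= z ord0 i + r].

Lemma grid_frac (N : nat) (k : 'I_N) : 0 <= (k%:R / N%:R : R) <= 1.
Proof.
have N0 : 0 < N%:R :> R by rewrite ltr0n (leq_ltn_trans _ (ltn_ord k)).
by rewrite divr_ge0//= ler_pdivrMr// mul1r ler_nat ltnW.
Qed.

Lemma grid_pt_in z r c w N (y : {ffun 'I_n -> 'I_N}) :
  0 <= r -> in_cube z r c w -> `|grid_pt c w y - z| <= r.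
Proof.
move=> r0 H; apply: norm_le_coord => // i; have [a b d] := H i.
have /andP[k0 k1] := grid_frac (y i).
rewrite mxE [grid_pt _ _ _ _ _]mxE [X in _ + X]mxE.
set k := _ / _ in k0 k1 *.
have p1 : 0 <= w ord0 i * k by rewrite mulr_ge0.
have p2 : w ord0 i * k <= w ord0 i by rewrite ler_piMr.
by rewrite ler_norml; apply/andP; split; lra.
Qed.

Lemma grid_avg_le N c w f f' : (forall y : {ffun 'I_n -> 'I_N},
  f (grid_pt c w y) <= f' (grid_pt c w y)) -> grid_avg N c w f <= grid_avg N c w f'.
Proof. by move=> H; rewrite ler_wpM2l ?invr_ge0 ?exprn_ge0//; apply: ler_sum. Qed.

Lemma grid_avg_cst N c w (a : R) : (0 < N)%N -> grid_avg N c w (cst a) = a.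
Proof.
move=> N0; rewrite /grid_avg sumr_const card_ffun !card_ord -[a *+ _]mulr_natl natrX.
by rewrite mulKf// expf_neq0// pnatr_eq0 -lt0n.
Qed.

Lemma grid_avgD N c w f f' :
  grid_avg N c w (f \+ f') = grid_avg N c w f + grid_avg N c w f'.
Proof. by rewrite /grid_avg big_split mulrDr. Qed.

Lemma grid_avg_sum N c w (I : Type) (s : seq I) (P : pred I) (F : I -> 'rV[R]_n -> R) :
  grid_avg N c w (fun v => \sum_(i <- s | P i) F i v) =
  \sum_(i <- s | P i) grid_avg N c w (F i).
Proof. by rewrite /grid_avg exchange_big mulr_sumr. Qed.

Lemma grid_avgZ N c w (a : R) f :
  grid_avg N c w (fun v => a * f v) = a * grid_avg N c w f.
Proof. by rewrite /grid_avg -mulr_sumr mulrCA. Qed.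

Section Axis.
Variables (Om : set 'rV[R]_n) (u g : 'rV[R]_n -> R) (z : 'rV[R]_n) (r om G : R) (N : nat).
Hypotheses (r0 : 0 <= r) (zOm : forall v, `|v - z| <= r -> Om v).
Hypothesis du : forall i v, Om v -> derivable u v (evec R i).
Hypothesis gu : forall i v, Om v -> `|partial u i v| <= g v.
Hypothesis gG : forall c w, in_cube z r c w -> (forall i, om <= w ord0 i) ->
  grid_avg N c w g <= G.

(** Along the linear homotopy between the two boxes each node moves parallel to axis [i], by at most
    2r for the corner and 2r for the side. The mean value theorem in the homotopy parameter gives an
    average of [d y] times a partial derivative over one intermediate box, whose sides are still at
    least [om]. *)
Lemma grid_avg_axis (i : 'I_n) c w c' w' :
  in_cube z r c w -> in_cube z r c' w' ->
  (forall k, om <= w ord0 k) -> (forall k, om <= w' ord0 k) ->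
  (forall k, k != i -> c' ord0 k = c ord0 k /\ w' ord0 k = w ord0 k) ->
  `|grid_avg N c' w' u - grid_avg N c w u| <= 4 * r * G.
Proof.
move=> cw cw' ow ow' eqk.
pose d (y : {ffun 'I_n -> 'I_N}) : R :=
  (c' ord0 i - c ord0 i) + (w' ord0 i - w ord0 i) * ((y i)%:R / N%:R).
pose ct (t : R) := (1 - t) *: c + t *: c'.
pose wt (t : R) := (1 - t) *: w + t *: w'.
have ptE t y : grid_pt (ct t) (wt t) y = grid_pt c w y + (t * d y) *: evec R i.
  apply/rowP => k; rewrite !mxE eqxx /=; have [->|ki] := eqVneq k i.
    by rewrite /d mulr1; ring.
  by have [-> ->] := eqk _ ki; rewrite mulr0 addr0; ring.
have ct1 : ct 1 = c' by rewrite /ct subrr scale0r add0r scale1r.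
have wt1 : wt 1 = w' by rewrite /wt subrr scale0r add0r scale1r.
have ct0 : ct 0 = c by rewrite /ct subr0 scale0r addr0 scale1r.
have wt0 : wt 0 = w by rewrite /wt subr0 scale0r addr0 scale1r.
have mix (t : R) : 0 <= t <= 1 -> in_cube z r (ct t) (wt t) /\ forall k, om <= wt t ord0 k.
  move=> /andP[t0 t1]; split=> k; rewrite !mxE.
    have [a1 a2 a3] := cw k; have [b1 b2 b3] := cw' k.
    have t1' : 0 <= 1 - t by rewrite subr_ge0.
    by split; nra.
  have := ow k; have := ow' k; nra.
pose F (t : R) := grid_avg N (ct t) (wt t) u.
pose dF (t : R) := (N%:R ^+ n)^-1 *
  \sum_(y : {ffun 'I_n -> 'I_N}) d y * partial u i (grid_pt (ct t) (wt t) y).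
have inOm (t : R) (y : {ffun 'I_n -> 'I_N}) : 0 <= t <= 1 -> Om (grid_pt (ct t) (wt t) y : 'rV[R]_n).
  by move=> /mix[h _]; apply: zOm; exact: grid_pt_in.
have FdF (t : R) : 0 <= t <= 1 -> is_derive t 1 F (dF t).
  move=> t01.
  have -> : F = fun t => (N%:R ^+ n)^-1 *:
      \sum_(y : {ffun 'I_n -> 'I_N}) u (grid_pt c w y + (t * d y) *: evec R i).
    by apply/funext => t'; congr (_ * _); apply: eq_bigr => y _; rewrite ptE.
  apply: is_deriveZ; apply: is_derive_bigsum => y.
  by rewrite ptE; apply: is_derive_line; apply: du; rewrite -ptE; exact: inOm.
have [t t01 Ft] : exists2 t, t \in `[0, 1]%R & F 1 - F 0 = dF t * (1 - 0).
  apply: MVT_segment => // [t|].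
    by rewrite in_itv /= => /andP[t0 t1]; apply: FdF; rewrite !ltW.
  apply: derivable_within_continuous => t; rewrite in_itv /= => t01.
  by have [] := FdF _ t01.
move: t01; rewrite in_itv /= => t01.
have -> : grid_avg N c' w' u = F 1 by rewrite /F ct1 wt1.
have -> : grid_avg N c w u = F 0 by rewrite /F ct0 wt0.
have [hin how] := mix _ t01.
rewrite Ft subr0 mulr1; apply: (@le_trans _ _ (4 * r * grid_avg N (ct t) (wt t) g)).
  rewrite /dF /grid_avg normrM ger0_norm ?invr_ge0 ?exprn_ge0// mulrCA.
  rewrite ler_wpM2l ?invr_ge0 ?exprn_ge0// mulr_sumr.
  apply: (le_trans (ler_norm_sum _ _ _)); apply: ler_sum => y _.
  rewrite normrM; apply: ler_pM; rewrite ?normr_ge0//; last exact/gu/inOm.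
  have [a1 a2 a3] := cw i; have [b1 b2 b3] := cw' i.
  have /andP[k0 k1] := grid_frac (y i).
  rewrite /d; set k := _ / _ in k0 k1 *.
  have -> : 4 * r = 2 * r + 2 * r * 1 by ring.
  apply: (le_trans (ler_normD _ _)); rewrite normrM; apply: lerD.
    by rewrite ler_norml; apply/andP; split; lra.
  apply: ler_pM; rewrite ?normr_ge0// ?(ger0_norm k0)//.
  by rewrite ler_norml; apply/andP; split; lra.
by rewrite ler_wpM2l ?mulr_ge0//; exact: gG.
Qed.

(** The coordinates are exchanged one by one: [hyb] takes the first [m] from the target box and the
    others from the initial one. *)
Lemma grid_avg_homotopy c w c' w' :
  in_cube z r c w -> in_cube z r c' w' ->
  (forall k, om <= w ord0 k) -> (forall k, om <= w' ord0 k) ->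
  `|grid_avg N c' w' u - grid_avg N c w u| <= n%:R * (4 * r * G).
Proof.
move=> cw cw' ow ow'.
pose hyb (a a' : 'rV[R]_n) (m : nat) : 'rV[R]_n :=
  \row_j (if (j < m)%N then a' ord0 j else a ord0 j).
have hyb0 a a' : hyb a a' 0%N = a by apply/rowP => j; rewrite mxE.
have hybn a a' : hyb a a' n = a' by apply/rowP => j; rewrite mxE ltn_ord.
have hin m : in_cube z r (hyb c c' m) (hyb w w' m).
  by move=> k; rewrite !mxE; case: ifP => _; [exact: cw'|exact: cw].
have how m k : om <= hyb w w' m ord0 k by rewrite mxE; case: ifP.
suff H m : (m <= n)%N -> `|grid_avg N (hyb c c' m) (hyb w w' m) u - grid_avg N c w u| <=
    m%:R * (4 * r * G).
  by have := H n (leqnn n); rewrite !hybn.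
elim: m => [_|m IH mn]; first by rewrite !hyb0 subrr normr0 mul0r.
rewrite -[in leRHS]natr1 mulrDl mul1r [leRHS]addrC.
rewrite (_ : _ - _ = (grid_avg N (hyb c c' m.+1) (hyb w w' m.+1) u -
  grid_avg N (hyb c c' m) (hyb w w' m) u) +
  (grid_avg N (hyb c c' m) (hyb w w' m) u - grid_avg N c w u)); last by ring.
apply: (le_trans (ler_normD _ _)); apply: lerD; last exact/IH/ltnW.
apply: (@grid_avg_axis (Ordinal mn)) => // k km.
have e : (k < m.+1)%N = (k < m)%N.
  by rewrite ltnS leq_eqVlt; case: eqP => // km'; case/eqP: km; apply/val_inj.
by rewrite !mxE e.
Qed.

End Axis.
End GridAverage.

(** * Proportion of grid points in a ball *)

Section Counting.
Context {R : realType} {n : nat}.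

(** The smallest and largest admissible indices a, b satisfy w (b - a) / N < 2r, and at most b - a +
    1 indices lie between them. *)
Lemma card_grid_interval (N : nat) (c w x r : R) : 0 < r -> 0 < w ->
  (#|[pred k : 'I_N | `|c + w * (k%:R / N%:R) - x| < r]|%:R : R)
    <= 2 * r * N%:R / w + 1.
Proof.
move=> r0 w0; set P := [pred k : 'I_N | _].
have rhs0 : 0 <= 2 * r * N%:R / w by rewrite divr_ge0 ?mulr_ge0 ?(ltW r0) ?(ltW w0).
case: (pickP P) => [k0 Pk0|P0]; last by rewrite eq_card0// addr_ge0.
have N0 : 0 < N%:R :> R by rewrite ltr0n (leq_ltn_trans _ (ltn_ord k0)).
case: (@arg_minnP _ k0 P (fun k => k : nat) Pk0) => a Pa mina.
case: (@arg_maxnP _ k0 P (fun k => k : nat) Pk0) => b Pb maxb.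
have ab : (a <= b)%N by exact: mina.
have card : (#|P| <= b - a + 1)%N.
  rewrite cardE -(size_map (@nat_of_ord N)) addn1 -subSn// -(size_iota a (b.+1 - a)).
  apply: uniq_leq_size; first by rewrite map_inj_uniq ?enum_uniq//; exact: ord_inj.
  move=> k' /mapP[k kP ->]; have Pk : P k by move: kP; rewrite mem_enum.
  rewrite mem_iota (subnKC (leqW ab)) ltnS; apply/andP; split; [exact: mina|exact: maxb].
apply: (@le_trans _ _ ((b - a)%:R + 1)).
  by rewrite natr1 ler_nat -addn1.
rewrite lerD2r ler_pdivlMr// natrB//.
move: Pa Pb; rewrite !inE !ltr_norml => /andP[a1 a2] /andP[b1 b2].
have : w * (b%:R / N%:R) - w * (a%:R / N%:R) < 2 * r by lra.
rewrite -mulrBr -mulrBl mulrA ltr_pdivrMr// => /ltW.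
by rewrite [w * _]mulrC.
Qed.

(** A sup-norm ball is a product of intervals, so the count factorises. The condition on [N] absorbs
    the extra 1 of each one-dimensional count and turns the factor 2 into 3. *)
Lemma grid_avg_ball (N : nat) (c w x : 'rV[R]_n) (om r : R) :
  (0 < N)%N -> 0 < r -> 0 < om -> (forall i, om <= w ord0 i) -> om / r <= N%:R ->
  grid_avg N c w (fun v => (`|v - x| < r)%R%:R) <= Num.min 1 ((3 * r / om) ^+ n).
Proof.
move=> N0 r0 om0 omw Nom; rewrite le_min; apply/andP; split.
  rewrite -[leRHS](@grid_avg_cst _ n N c w 1)//; apply: grid_avg_le => y /=.
  by case: (_ < _).
have N0R : 0 < N%:R :> R by rewrite ltr0n.
pose P i := [pred k : 'I_N | `|c ord0 i + w ord0 i * (k%:R / N%:R) - x ord0 i| < r].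
rewrite /grid_avg mulrC ler_pdivrMr ?exprn_gt0//.
apply: (@le_trans _ _ (#|family P|%:R)).
  rewrite -sum1_card natr_sum [leRHS]big_mkcond; apply: ler_sum => y _.
  case: (boolP (`|_| < r)) => [lt|_]; last by case: ifP.
  rewrite ifT//; apply/familyP => i; rewrite inE.
  apply: le_lt_trans lt; have := coord_le_norm (grid_pt c w y - x) i.
  by rewrite !mxE.
rewrite card_family foldrE big_map big_enum /= natr_prod -exprMn.
apply: (@le_trans _ _ (\prod_(i < n) (3 * r / om * N%:R))); last first.
  by rewrite prodr_const card_ord.
apply: ler_prod => i _; rewrite ler0n /=.
have wi0 : 0 < w ord0 i by apply: (lt_le_trans om0).
apply: (le_trans (card_grid_interval _ _ _ r0 wi0)).
have h1 : 2 * r * N%:R / w ord0 i <= 2 * r * N%:R / om.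
  by rewrite ler_wpM2l ?mulr_ge0 ?(ltW r0)// lef_pV2.
have h2 : 1 <= r * N%:R / om.
  by rewrite ler_pdivlMr// mul1r mulrC -ler_pdivrMr.
have -> : 3 * r / om * N%:R = 2 * r * N%:R / om + r * N%:R / om by ring.
exact: lerD.
Qed.

End Counting.

(** * Averages of the gradient bounded by weighted balls *)

Section Atoms.
Context {R : realType} {n : nat}.
Variables (Om : set 'rV[R]_n) (g : 'rV[R]_n -> R).
Variables (xs : nat -> 'rV[R]_n) (rs av : nat -> R).
Hypotheses (rs0 : forall j, 0 < rs j) (av0 : forall j, 0 < av j).
Hypothesis cg : forall v, Om v -> {for v, continuous g}.
Hypothesis dom : forall v, Om v -> 0 < g v -> exists j, `|v - xs j| < rs j /\ g v < av j.

Lemma compact_sup_ball (z : 'rV[R]_n) (r : R) : compact [set v | `|v - z| <= r].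
Proof.
have [r0|r0] := leP 0 r; last first.
  rewrite (_ : [set _ | _] = set0); first exact: compact0.
  by apply/seteqP; split=> // v /= h; have := normr_ge0 (v - z); rewrite leNgt (le_lt_trans h r0).
rewrite (_ : [set _ | _] = [set v : 'rV[R]_n | forall i,
    `[z ord0 i - r, z ord0 i + r]%classic (v ord0 i)]).
  apply: (@rV_compact _ _ (fun i => `[z ord0 i - r, z ord0 i + r]%classic)) => i.
  exact: segment_compact.
apply/seteqP; split=> v /= H.
  move=> i; have := le_trans (coord_le_norm (v - z) i) H.
  by rewrite !mxE ler_distl /= in_itv.
apply: norm_le_coord => // i; have := H i.
by rewrite !mxE ler_distl /= in_itv.
Qed.

(** Compactness of the closed cube. The tolerance [e] takes care of the points where [g] vanishes,
    at which [dom] provides no ball. *)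
Lemma finite_domination z (r e : R) : (forall v, `|v - z| <= r -> Om v) -> 0 < e ->
  exists m, forall v, `|v - z| <= r ->
    g v < e \/ exists j, [/\ (j < m)%N, `|v - xs j| < rs j & g v < av j].
Proof.
move=> zOm e0.
pose P (m : nat) v := g v < e \/ exists j, [/\ (j < m)%N, `|v - xs j| < rs j & g v < av j].
(* Taking the filter of large integers as parameter, the covering property yields one bound [m]
   valid on the whole cube. *)
have /compact_near_coveringP/(_ nat \oo P) := @compact_sup_ball z r.
case.
  move=> v /zOm Ov; have cgv := cg Ov.
  have [gv|] := ltP 0 (g v); last first.
    move=> gle; have gve : g v < e by apply: le_lt_trans e0.
    have nv : \forall v' \near v, g v' < e by exact: (cvgr_lt _ cgv).
    exists ([set v' | g v' < e], setT); first by split=> //; exact: filterT.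
    by move=> [v' m] /= [h _]; left.
  have [j [vj ga]] := dom Ov gv.
  have nv : \forall v' \near v, g v' < av j by exact: (cvgr_lt _ cgv).
  have nb : \forall v' \near v, `|v' - xs j| < rs j.
    have d0 : 0 < rs j - `|v - xs j| by rewrite subr_gt0.
    apply: filterS (nbhsx_ballx v _ d0) => v'; rewrite -ball_normE /= => h.
    rewrite -(subrK v v') -addrA; apply: (le_lt_trans (ler_normD _ _)).
    by rewrite distrC -ltrBrDr.
  exists ([set v' | g v' < av j /\ `|v' - xs j| < rs j], [set m | (j < m)%N]).
    by split; [exact: filterI|exists j.+1].
  by move=> [v' m] /= [[h1 h2] h3]; right; exists j.
by move=> m _ H; exists m => v vz; exact: (H m (leqnn m) v vz).
Qed.

(** [N] is both the grid size and the truncation of the sum: the threshold makes it exceed the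
    finitely many balls that dominate [g] and resolve each of them at side [om]. *)
Lemma grid_avg_atoms z (r om e : R) : (forall v, `|v - z| <= r -> Om v) ->
  0 <= r -> 0 < om -> 0 < e ->
  exists N0, forall N, (N0 <= N)%N -> forall c w, in_cube z r c w ->
    (forall i, om <= w ord0 i) ->
  grid_avg N c w g <= \sum_(0 <= j < N | `|xs j - z| < rs j + r)
    av j * Num.min 1 ((3 * rs j / om) ^+ n) + e.
Proof.
move=> zOm r0 om0 e0; have [m Hm] := finite_domination zOm e0.
have [N1 HN1] : exists N1 : nat, forall j, (j < m)%N -> om / rs j <= N1%:R.
  elim: (m) => [|m' [N1 IH]]; first by exists 0%N.
  exists (maxn N1 (Num.bound (om / rs m'))) => j.
  rewrite ltnS leq_eqVlt => /orP[/eqP ->|/IH h].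
    apply: (@le_trans _ _ (Num.bound (om / rs m'))%:R).
      by apply/ltW/archi_boundP; rewrite divr_ge0// ltW.
    by rewrite ler_nat leq_maxr.
  by apply: (le_trans h); rewrite ler_nat leq_maxl.
exists (maxn m N1).+1 => N; rewrite gtn_max => /andP[mN N1N] c w cw omw.
have N0 : (0 < N)%N by exact: leq_ltn_trans mN.
pose near_ j := `|xs j - z| < rs j + r.
pose h v := \sum_(0 <= j < m | near_ j) av j * (`|v - xs j| < rs j)%R%:R.
apply: (@le_trans _ _ (grid_avg N c w (h \+ cst e))).
  apply: grid_avg_le => y /=; have yz := grid_pt_in y r0 cw.
  set v := grid_pt c w y in yz *.
  have hge : forall j, near_ j -> 0 <= av j * (`|v - xs j| < rs j)%R%:R.
    by move=> j _; rewrite mulr_ge0// ltW.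
  case: (Hm _ yz) => [/ltW ge|[j [jm vj gj]]].
    by apply: (le_trans ge); rewrite lerDr sumr_ge0.
  have nj : near_ j.
    rewrite /near_ -(subrK v (xs j)) -addrA.
    by apply: (le_lt_trans (ler_normD _ _)); rewrite distrC ltr_leD.
  rewrite -[leLHS]addr0; apply: lerD; last exact: ltW.
  rewrite /h big_mkord (bigD1 (Ordinal jm))//= vj mulr1.
  by apply: (le_trans (ltW gj)); rewrite lerDl sumr_ge0// => i /andP[/hge].
rewrite grid_avgD grid_avg_cst// lerD2r grid_avg_sum.
apply: (@le_trans _ _ (\sum_(0 <= j < m | near_ j)
    av j * Num.min 1 ((3 * rs j / om) ^+ n))).
  rewrite big_nat_cond [leRHS]big_nat_cond.
  apply: ler_sum => j /andP[/andP[_ jm] nj].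
  rewrite grid_avgZ ler_wpM2l//; first exact: ltW.
  apply: grid_avg_ball => //; apply: (le_trans (HN1 _ jm)).
  by rewrite ler_nat ltnW.
rewrite [leRHS](big_cat_nat (leq0n m) (ltnW mN))//= lerDl.
apply: sumr_ge0 => j _; rewrite mulr_ge0 ?(ltW (av0 j))// le_min ler01 /=.
by rewrite exprn_ge0// divr_ge0 ?mulr_ge0 ?(ltW (rs0 j)) ?(ltW om0).
Qed.

End Atoms.

Section PointLimit.
Context {R : realType} {n : nat}.
Variables (Om : set 'rV[R]_n) (u g : 'rV[R]_n -> R).
Hypothesis oOm : open Om.
Hypothesis g0 : forall v, 0 <= g v.
Hypothesis cg : forall v, Om v -> {for v, continuous g}.
Hypothesis du : forall i v, Om v -> derivable u v (evec R i).
Hypothesis gu : forall i v, Om v -> `|partial u i v| <= g v.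

(* Degenerate case [w = 0] of the homotopy bound: this replaces the continuity
   of [u], which is not among the hypotheses. *)
Lemma grid_avg_point x e : Om x -> 0 < e -> exists2 eta, 0 < eta &
  forall N, (0 < N)%N -> forall r c w, r <= eta -> in_cube x r c w ->
    `|grid_avg N c w u - u x| <= e.
Proof.
move=> Ox e0.
have [d d0 Hd] : exists2 d : R, 0 < d & forall v, `|v - x| < d -> Om v /\ g v < g x + 1.
  have n1 : \forall v \near x, Om v by exact: open_nbhs_nbhs.
  have n2 : \forall v \near x, g v < g x + 1.
    by apply: (cvgr_lt _ (cg Ox)); rewrite ltrDl.
  have : nbhs x [set v | Om v /\ g v < g x + 1] by exact: filterI.
  move=> /nbhs_ballP[d /= d0 Hd].
  by exists d => // v vd; apply: Hd; rewrite -ball_normE /= distrC.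
have gx1 : 0 < g x + 1 by rewrite ltr_wpDl.
pose D := n%:R * (4 * (g x + 1)) + 1.
have D0 : 0 < D by rewrite ltr_wpDl// !mulr_ge0// ltW.
exists (Num.min (d / 2) (e / D)); first by rewrite lt_min !divr_gt0.
move=> N N0 r c w; rewrite le_min => /andP[rd re] cw.
(* The inequality 0 <= r is read off from a coordinate, so dimension 0, where all grid points
   coincide with [x], is treated apart. *)
have [[i]|noI] := pselect (exists i : 'I_n, True); last first.
  have -> : grid_avg N c w u = grid_avg N c w (cst (u x)).
    rewrite /grid_avg; congr (_ * _); apply: eq_bigr => y _ /=; congr u.
    by apply/rowP => i; exfalso; apply: noI; exists i.
  by rewrite grid_avg_cst// subrr normr0 ltW.
move=> _; have r0 : 0 <= r by have [a b h] := cw i; lra.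
have xin : in_cube x r x 0 by move=> k; rewrite mxE; split; lra.
have -> : u x = grid_avg N x 0 u.
  rewrite -[LHS](@grid_avg_cst _ n N c w (u x))//.
  rewrite /grid_avg; congr (_ * _); apply: eq_bigr => y _ /=; congr u.
  by apply/rowP => k; rewrite !mxE mul0r addr0.
have inOm v : `|v - x| <= r -> Om v /\ g v < g x + 1.
  by move=> vr; apply: Hd; apply: (le_lt_trans vr); lra.
apply: (@le_trans _ _ (n%:R * (4 * r * (g x + 1)))).
  apply: (@grid_avg_homotopy _ _ Om u g x r 0) => //.
  - by move=> v /inOm[].
  - move=> c1 w1 cw1 _; rewrite -[leRHS](@grid_avg_cst _ n N c1 w1)//.
    by apply: grid_avg_le => y /=; have [_ /ltW] := inOm _ (grid_pt_in y r0 cw1).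
  - by move=> k; rewrite mxE.
  - by move=> k; have [] := cw k.
apply: (@le_trans _ _ (D * r)); last by rewrite mulrC -ler_pdivlMr.
rewrite /D; nra.
Qed.

End PointLimit.

(** * Chains of cubes *)

Section Lattice.
Context {R : realType} {n : nat}.
Implicit Types (p v : 'rV[int]_n).

(** In each coordinate the admissible integers lie in an interval of length 2r / h; subtracting [lo]
    injects them into K + 1 <= 2r / h + 2 values. *)
Lemma lattice_count (x : 'rV[R]_n) (h r : R) (s : seq 'rV[int]_n) :
  0 < h -> 0 <= r -> uniq s -> (forall v, v \in s -> `|x - corner h v| < r) ->
  (size s)%:R <= (2 * r / h + 2) ^+ n.
Proof.
move=> h0 r0 us sr.
pose lo (i : 'I_n) : int := Num.floor ((x ord0 i - r) / h).
pose K := Num.trunc (2 * r / h + 1).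
have y0 : 0 <= 2 * r / h by rewrite divr_ge0 ?mulr_ge0 ?(ltW h0).
have /andP[K1 K2] : K%:R <= 2 * r / h + 1 < K.+1%:R by rewrite truncn_itv// addr_ge0.
have bnd v i : v \in s -> (0 <= v ord0 i - lo i)%R /\ (absz (v ord0 i - lo i)%R < K.+1)%N.
  move=> /sr vr; have := le_lt_trans (coord_le_norm _ i) vr.
  rewrite !mxE ltr_distl; set a := x ord0 i; set w := v ord0 i => /andP[v1 v2].
  have := floor_le ((a - r) / h); have := floorD1_gt ((a - r) / h); rewrite intrD1.
  rewrite -/(lo i) => l1 l2.
  have w1 : (a - r) / h < w%:~R by rewrite ltr_pdivrMr// mulrC; lra.
  have w2 : w%:~R < (a - r) / h + 2 * r / h.
    by rewrite -mulrDl ltr_pdivlMr// mulrC; lra.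
  have d0 : (0 <= w - lo i)%R by rewrite subr_ge0 -(ler_int R); lra.
  split=> //; rewrite -(ltr_nat R) -[X in X < _](_ : (w - lo i)%:~R = _); last first.
    by rewrite -[in LHS](gez0_abs d0).
  by apply: lt_trans K2; rewrite intrB; lra.
pose F v : {ffun 'I_n -> 'I_K.+1} := [ffun i => inord (absz (v ord0 i - lo i)%R)].
have Finj : {in s &, injective F}.
  move=> v v' vs vs' /ffunP e; apply/rowP => i; have := e i; rewrite !ffunE.
  have [a1 a2] := bnd _ i vs; have [b1 b2] := bnd _ i vs'.
  move=> /(congr1 val); rewrite /= !inordK// => eab.
  have : (v ord0 i - lo i = v' ord0 i - lo i)%R by rewrite -(gez0_abs a1) -(gez0_abs b1) eab.
  by move=> /addIr.
apply: (@le_trans _ _ (K.+1 ^ n)%:R).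
  have cardF : #|{: {ffun 'I_n -> 'I_K.+1}}| = (K.+1 ^ n)%N by rewrite card_ffun !card_ord.
  by rewrite ler_nat -cardF -(size_map F) -(card_uniqP _) ?max_card// map_inj_in_uniq.
rewrite natrX lerXn2r ?nnegrE// ?addr_ge0// -natr1; lra.
Qed.

(** Adjacency includes diagonal neighbours and equality, since consecutive samples of a curve may
    fall in the same cell. *)
Definition lattice_adj p v := [forall i, (`|p ord0 i - v ord0 i| <= 1)%R].

Lemma lattice_adj_corner (h : R) p v : 0 <= h -> lattice_adj p v ->
  `|corner h v - corner h p| <= h.
Proof.
move=> h0 /forallP a; apply: norm_le_coord => // i; rewrite !mxE -mulrBr -intrB.
rewrite normrM ger0_norm// ler_piMr// -intr_norm (_ : 1 = 1%:~R)// ler_int distrC.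
exact: a.
Qed.

Lemma cell_lattice_adj (h : R) (x y : 'rV[R]_n) : 0 < h -> `|x - y| <= h ->
  lattice_adj (cell h x) (cell h y).
Proof.
move=> h0 xy; apply/forallP => i; have := cell_near i h0 xy; lia.
Qed.

(* Removing the loops of the sequence of lattice cells met by the curve is what
   bounds the number of cells near a given ball independently of the curve. *)
Lemma curve_lattice_path (gam : R -> 'rV[R]_n) (a b h : R) : a <= b -> 0 < h ->
  (forall t t', a <= t -> t <= t' -> t' <= b -> `|gam t' - gam t| <= t' - t) ->
  exists s : seq 'rV[int]_n, [/\ path lattice_adj (cell h (gam a)) s,
    last (cell h (gam a)) s = cell h (gam b),
    uniq (cell h (gam a) :: s), (size s)%:R <= (b - a) / h + 1 &
    forall v, v \in cell h (gam a) :: s -> exists t, a <= t <= b /\ v = cell h (gam t)].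
Proof.
move=> ab h0 lip.
have y0 : 0 <= (b - a) / h by rewrite divr_ge0 ?subr_ge0 ?(ltW h0).
(* Enough samples for consecutive ones to be at distance at most [h], hence in adjacent cells. *)
pose M := (Num.trunc ((b - a) / h)).+1.
have /andP[M1 M2] := truncn_itv y0; rewrite -/M in M2.
have M0 : 0 < M%:R :> R by [].
pose tt (i : nat) := a + (b - a) * (i%:R / M%:R).
pose q i := cell h (gam (tt i)).
have tt0 : tt 0%N = a by rewrite /tt mul0r mulr0 addr0.
have ttM : tt M = b by rewrite /tt mulfV ?gt_eqF// mulr1 addrC subrK.
have step : (b - a) / M%:R <= h.
  by rewrite ler_pdivrMr// mulrC -ler_pdivrMr// ltW.
have ttS i : tt i.+1 = tt i + (b - a) / M%:R.
  by rewrite /tt -natr1; ring.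
have step0 : 0 <= (b - a) / M%:R by rewrite divr_ge0 ?subr_ge0.
have ttle i : (i <= M)%N -> a <= tt i <= b.
  move=> iM; rewrite /tt lerDl mulr_ge0 ?subr_ge0// ?divr_ge0//=.
  rewrite -lerBrDl ler_piMr ?subr_ge0// ler_pdivrMr// mul1r ler_nat//.
have pth m i : (i + m <= M)%N -> path lattice_adj (q i) [seq q k | k <- iota i.+1 m].
  elim: m i => [//|m IH] i im /=; apply/andP; split; last by apply: IH; lia.
  apply: cell_lattice_adj => //.
  have /andP[t1 t2] := ttle i ltac:(lia); have /andP[t3 t4] := ttle i.+1 ltac:(lia).
  rewrite distrC; apply: le_trans step; rewrite ttS in t4 *.
  apply: (le_trans (lip _ _ t1 _ t4)); first by rewrite lerDl.
  by rewrite addrAC subrr add0r.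
pose s0 := [seq q k | k <- iota 1 M].
have lst : last (q 0%N) s0 = q M by rewrite /s0 last_map -(nth_last 0%N) size_iota nth_iota.
have {pth} := pth M 0%N (leqnn _); rewrite -/s0.
have -> : cell h (gam a) = q 0%N by rewrite /q tt0.
have -> : cell h (gam b) = q M by rewrite /q ttM.
rewrite -lst => /shortenP[s ps us sub]; exists s; split=> //.
  move: us => /= /andP[_ us]; have := uniq_leq_size us sub.
  rewrite size_map size_iota -(ler_nat R) => /le_trans; apply.
  by rewrite /M -natr1 lerD2r.
move=> v; rewrite inE => /orP[/eqP->|/sub/mapP[k]].
  by exists (tt 0%N); split=> //; exact: ttle.
by rewrite mem_iota => /andP[_ kM] ->; exists (tt k); split=> //; apply: ttle; lia.
Qed.

End Lattice.

(** * Variation of the cube averages at one scale *)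

Section ScaleStep.
Context {R : realType} {n : nat}.
Variables (Om : set 'rV[R]_n) (u g : 'rV[R]_n -> R).
Variables (xs : nat -> 'rV[R]_n) (rs av : nat -> R).
Hypotheses (rs0 : forall j, 0 < rs j) (av0 : forall j, 0 < av j).
Hypothesis cg : forall v, Om v -> {for v, continuous g}.
Hypothesis du : forall i v, Om v -> derivable u v (evec R i).
Hypothesis gu : forall i v, Om v -> `|partial u i v| <= g v.
Hypothesis dom : forall v, Om v -> 0 < g v -> exists j, `|v - xs j| < rs j /\ g v < av j.

Definition cube_avg N (h : R) (p : 'rV[int]_n) : R :=
  grid_avg N (corner h p) (const_mx h) u.

(** The weight [av j] times the bound on the proportion of a box with sides at least [om] that the
    ball [j] can occupy. *)
Definition ball_mass (om : R) j : R := av j * Num.min 1 ((3 * rs j / om) ^+ n).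

Lemma ball_mass_ge0 om j : 0 < om -> 0 <= ball_mass om j.
Proof.
move=> om0; rewrite mulr_ge0 ?(ltW (av0 j))// le_min ler01 /=.
by rewrite exprn_ge0// divr_ge0 ?mulr_ge0 ?(ltW (rs0 j)) ?(ltW om0).
Qed.

Lemma homotopy_mass z (r om e : R) c w c' w' :
  (forall v, `|v - z| <= r -> Om v) -> 0 <= r -> 0 < om -> 0 < e ->
  in_cube z r c w -> in_cube z r c' w' ->
  (forall k, om <= w ord0 k) -> (forall k, om <= w' ord0 k) ->
  exists N0, forall N, (N0 <= N)%N ->
  `|grid_avg N c' w' u - grid_avg N c w u| <=
    n%:R * (4 * r * \sum_(0 <= j < N | `|xs j - z| < rs j + r) ball_mass om j) + e.
Proof.
move=> zOm r0 om0 e0 cw cw' ow ow'.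
(* The error on the averages of [g] is multiplied by 4rn, so it is taken as e / D; the summand 1
   keeps [D] positive when r = 0. *)
pose D := n%:R * (4 * r) + 1.
have D0 : 0 < D by rewrite ltr_wpDl// !mulr_ge0.
have [N0 H] := grid_avg_atoms rs0 av0 cg dom zOm r0 om0 (divr_gt0 e0 D0).
exists N0 => N NN; set S := \sum_(_ <= _ < _ | _) _.
apply: (@le_trans _ _ (n%:R * (4 * r * (S + e / D)))).
  apply: (@grid_avg_homotopy _ _ Om u g z r om) => //.
  by move=> c1 w1 cw1 ow1; exact: H.
rewrite 2!mulrDr lerD2l mulrA; apply: (@le_trans _ _ (D * (e / D))).
  by rewrite (ler_wpM2r (ltW (divr_gt0 e0 D0)))// lerDl.
by rewrite mulrC divfK// gt_eqF.
Qed.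

(** Two adjacent cubes of side [h] both lie in the sup-norm ball of radius 2h about the first
    corner, so each step of the path is one homotopy. *)
Lemma path_mass (h e : R) (p0 : 'rV[int]_n) (s : seq 'rV[int]_n) :
  0 < h -> 0 < e -> path lattice_adj p0 s ->
  (forall p, p \in p0 :: s -> forall v, `|v - corner h p| <= 2 * h -> Om v) ->
  exists N0, forall N, (N0 <= N)%N ->
  `|cube_avg N h (last p0 s) - cube_avg N h p0| <=
    \sum_(p <- p0 :: s) n%:R * (4 * (2 * h) *
      \sum_(0 <= j < N | `|xs j - corner h p| < rs j + 2 * h) ball_mass h j) + e.
Proof.
move=> h0; elim: s p0 e => [|p1 s IH] p0 e e0 /=.
  move=> _ _; exists 0%N => N _; rewrite subrr normr0 addr_ge0 ?(ltW e0)//.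
  rewrite big_seq1 !mulr_ge0 ?(ltW h0)// sumr_ge0// => j _; exact: ball_mass_ge0.
move=> /andP[p01 ps] H.
have e2 : 0 < e / 2 by rewrite divr_gt0.
have [|N1 H1] := IH p1 _ e2 ps.
  by move=> p ps'; apply: H; rewrite inE ps' orbT.
have hh : 0 <= 2 * h by rewrite mulr_ge0// ltW.
have := @homotopy_mass (corner h p0) (2 * h) h (e / 2) (corner h p0) (const_mx h)
  (corner h p1) (const_mx h).
case => //.
- by apply: H; rewrite mem_head.
- by move=> k; rewrite [const_mx _ _ _]mxE; split; lra.
- move=> k; rewrite [const_mx _ _ _]mxE.
  have := le_trans (coord_le_norm _ k) (lattice_adj_corner (ltW h0) p01).
  rewrite mxE [X in _ + X]mxE ler_distl => /andP[a b]; split; lra.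
- by move=> k; rewrite mxE.
- by move=> k; rewrite mxE.
move=> N2 H2; exists (maxn N1 N2) => N; rewrite geq_max => /andP[/H1 {}H1 /H2 {}H2].
rewrite big_cons (_ : _ - _ = (cube_avg N h (last p1 s) - cube_avg N h p1) +
  (cube_avg N h p1 - cube_avg N h p0)); last by ring.
apply: (le_trans (ler_normD _ _)); apply: (le_trans (lerD H1 H2)); lra.
Qed.

Variables (x : 'rV[R]_n) (gam : R -> 'rV[R]_n) (a b h : R).
Hypotheses (a0 : 0 <= a) (ab : a <= b) (h0 : 0 < h) (hb : h <= b).
Hypothesis gam0 : gam 0 = x.
Hypothesis lip : forall t t', 0 <= t -> t <= t' -> t' <= b ->
  `|gam t' - gam t| <= t' - t.
Hypothesis tube : forall t, a <= t -> t <= b -> forall v, `|v - gam t| <= 3 * h -> Om v.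

(** Share of the ball [j] in the variation at mesh [h] up to arc length [b]. The test discards balls
    out of reach. In the minimum, the first term counts the cubes near the ball by volume, the
    second by the length of the chain; it is the better one for large balls. *)
Definition scale_weight (x : 'rV[R]_n) (b h : R) j : R :=
  if rs j + `|x - xs j| <= 2 * rs j + 4 * b
  then 8 * n%:R * (av j * Num.min (24 ^+ n * (h * (rs j / h) ^+ n)) (3 * b)) else 0.

Let near_x t : a <= t -> t <= b -> `|x - gam t| <= b.
Proof.
move=> at_ tb; have t0 := le_trans a0 at_; rewrite -gam0 distrC.
by apply: (le_trans (lip (lexx 0) t0 tb)); rewrite subr0.
Qed.

Let touch t (c : 'rV[R]_n) d j : a <= t -> t <= b -> `|gam t - c| <= h ->
  d <= 2 * h -> `|xs j - c| < rs j + d -> rs j + `|x - xs j| <= 2 * rs j + 4 * b.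
Proof.
move=> at_ tb tc dh jc.
have h1 : `|x - xs j| <= b + (h + (rs j + d)).
  have -> : x - xs j = (x - gam t) + ((gam t - c) + (c - xs j)) by rewrite !subrKA.
  apply: (le_trans (ler_normD _ _)); apply: lerD; first exact: near_x.
  apply: (le_trans (ler_normD _ _)); apply: lerD => //.
  by rewrite distrC ltW.
apply: (@le_trans _ _ (rs j + (b + (h + (rs j + d))))); first by rewrite lerD2l.
by have := hb; lra.
Qed.

Let scale_weight_ge0 j : 0 <= scale_weight x b h j.
Proof.
rewrite /scale_weight; case: ifP => // _.
rewrite !mulr_ge0 ?(ltW (av0 j))// le_min; apply/andP; split.
  by rewrite !mulr_ge0 ?exprn_ge0 ?divr_ge0 ?(ltW h0) ?(ltW (rs0 j)).
by rewrite mulr_ge0// (le_trans a0).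
Qed.

(** If r <= h, the count is at most 8^n and the proportion at most (3r / h)^n. If r >= h, the
    proportion is at most 1 and the count at most (8r / h)^n. *)
Let pow_bound (r : R) : 0 < r ->
  Num.min 1 ((3 * r / h) ^+ n) * (2 * (r + 2 * h) / h + 2) ^+ n <= 24 ^+ n * (r / h) ^+ n.
Proof.
move=> r0; have q0 : 0 <= r / h by rewrite divr_ge0 ?ltW.
have -> : 2 * (r + 2 * h) / h + 2 = 2 * (r / h) + 6.
  by field; rewrite gt_eqF.
have b0 : 0 <= 2 * (r / h) + 6 by rewrite addr_ge0// mulr_ge0.
rewrite -mulrA -exprMn; set q := r / h in q0 b0 *; clearbody q.
have m0 : 0 <= Num.min 1 ((3 * q) ^+ n) by rewrite le_min ler01 /= exprn_ge0// mulr_ge0.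
have [q1|/ltW q1] := leP q 1.
  apply: (@le_trans _ _ ((3 * q) ^+ n * 8 ^+ n)).
    apply: ler_pM => //; first by rewrite exprn_ge0.
      by rewrite ge_min lexx orbT.
    by apply: lerXn2r; rewrite ?nnegrE//; lra.
  by rewrite -exprMn mulrAC (_ : 3 * 8 = 24 :> R)//; ring.
apply: (@le_trans _ _ (1 * (8 * q) ^+ n)).
  apply: ler_pM => //; first by rewrite exprn_ge0.
    by rewrite ge_min lexx.
  by apply: lerXn2r; rewrite ?nnegrE ?mulr_ge0//; lra.
by rewrite mul1r; apply: lerXn2r; rewrite ?nnegrE ?mulr_ge0//; lra.
Qed.

(** After exchanging the sums, each ball is multiplied by the number of cubes of the chain near it.
    As the chain repeats no cube, that number is bounded by a lattice count as well as by the length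
    of the chain. *)
Lemma curve_mass (e : R) : 0 < e -> exists N0, forall N, (N0 <= N)%N ->
  `|cube_avg N h (cell h (gam b)) - cube_avg N h (cell h (gam a))| <=
    \sum_(0 <= j < N) scale_weight x b h j + e.
Proof.
move=> e0.
have [|s [ps <- us sz vs]] := @curve_lattice_path _ _ gam a b h ab h0.
  by move=> t t' at_; apply: lip; exact: le_trans at_.
have [|N0 H] := path_mass h0 e0 ps.
  move=> p /vs[t [/andP[at_ tb] ->]] v vc; apply: (tube at_ tb).
  rewrite -(subrK (corner h (cell h (gam t))) v) -addrA.
  apply: (le_trans (ler_normD _ _)); have := cell_corner_dist (gam t) h0.
  by rewrite distrC; lra.
exists N0 => N /H{}H; apply: (le_trans H); rewrite lerD2r.
set S := cell h (gam a) :: s in us vs *.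
rewrite (eq_bigr (fun p => \sum_(0 <= j < N)
    8 * n%:R * h * ball_mass h j * (`|xs j - corner h p| < rs j + 2 * h)%R%:R)); last first.
  move=> p _; rewrite mulr_sumr mulr_sumr big_mkcond; apply: eq_bigr => j _.
  by case: ifP => _; rewrite ?mulr0 ?mulr1//; ring.
rewrite exchange_big /=; apply: ler_sum => j _; rewrite -mulr_sumr.
set P := fun p : 'rV[int]_n => `|xs j - corner h p| < rs j + 2 * h.
have -> : \sum_(p <- S) (P p)%:R = (size (seq.filter P S))%:R :> R.
  rewrite size_filter -sum1_count natr_sum [in RHS]big_mkcond.
  by apply: eq_bigr => p _; case: (P p).
case e1 : (seq.filter P S) => [|p0 s']; first by rewrite /= mulr0.
have : p0 \in seq.filter P S by rewrite e1 mem_head.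
rewrite mem_filter => /andP[Pp0 /vs[t [/andP[at_ tb] p0t]]].
have tch : rs j + `|x - xs j| <= 2 * rs j + 4 * b.
  apply: (touch at_ tb (c := corner h p0) _ (lexx _) Pp0).
  by rewrite p0t cell_corner_dist.
rewrite /scale_weight tch /ball_mass -e1.
rewrite (_ : _ * _ = 8 * n%:R * (av j * (h * (Num.min 1 ((3 * rs j / h) ^+ n) *
  (size (seq.filter P S))%:R)))); last by ring.
rewrite ler_wpM2l ?mulr_ge0// ler_pM2l//.
have sizeF : (size (seq.filter P S))%:R <= (b - a) / h + 2.
  apply: (@le_trans _ _ (size S)%:R).
    by rewrite ler_nat size_filter count_size.
  by rewrite /S /= -natr1; lra.
have latF : (size (seq.filter P S))%:R <= (2 * (rs j + 2 * h) / h + 2) ^+ n.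
  apply: (@lattice_count _ _ (xs j)) => //.
  - by rewrite addr_ge0 ?mulr_ge0 ?(ltW (rs0 j)) ?(ltW h0).
  - exact: filter_uniq.
  - by move=> p; rewrite mem_filter => /andP[].
have m1 : Num.min 1 ((3 * rs j / h) ^+ n) <= 1 by rewrite ge_min lexx.
have m0 : 0 <= Num.min 1 ((3 * rs j / h) ^+ n).
  by rewrite le_min ler01 /= exprn_ge0// divr_ge0 ?mulr_ge0 ?(ltW (rs0 j)) ?(ltW h0).
rewrite le_min; apply/andP; split.
  rewrite [leRHS]mulrCA ler_pM2l//; apply: le_trans (pow_bound (rs0 j)).
  by rewrite ler_wpM2l.
(* The total is (b - a) + 2h, at most 3b because a >= 0 and h <= b. *)
apply: (@le_trans _ _ (h * ((b - a) / h + 2))).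
  rewrite ler_pM2l//; apply: le_trans sizeF; by rewrite ler_piMl.
rewrite mulrDr [h * (_ / h)]mulrC divfK ?gt_eqF//. have := hb; have := a0; lra.
Qed.

(** The cubes of sides [h] and h / 2 that contain [gam a] lie in the ball of radius [h] around it,
    so one homotopy with sides at least h / 2 passes to the next mesh. *)
Lemma halving_mass (e : R) : 0 < e -> exists N0, forall N, (N0 <= N)%N ->
  `|cube_avg N (h / 2) (cell (h / 2) (gam a)) - cube_avg N h (cell h (gam a))| <=
    \sum_(0 <= j < N) scale_weight x b h j + e.
Proof.
move=> e0; have h20 : 0 < h / 2 by rewrite divr_gt0.
have := @homotopy_mass (gam a) h (h / 2) e (corner h (cell h (gam a))) (const_mx h)
  (corner (h / 2) (cell (h / 2) (gam a))) (const_mx (h / 2)).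
case => //.
- by move=> v vg; apply: (tube (lexx _) ab); apply: (le_trans vg); lra.
- exact: ltW.
- move=> k; rewrite [const_mx _ _ _]mxE.
  by have /andP[c1 c2] := cellP (gam a) k h0; split; lra.
- move=> k; rewrite [const_mx _ _ _]mxE.
  by have /andP[c1 c2] := cellP (gam a) k h20; split; lra.
- by move=> k; rewrite mxE; lra.
- by move=> k; rewrite mxE; lra.
move=> N0 H; exists N0 => N /H{}H; apply: (le_trans H); rewrite lerD2r.
rewrite mulr_sumr mulr_sumr big_mkcond; apply: ler_sum => j _.
case: ifPn => [jn|_]; last exact: scale_weight_ge0.
have tch : rs j + `|x - xs j| <= 2 * rs j + 4 * b.
  apply: (touch (lexx _) ab (c := gam a) _ _ jn); first by rewrite subrr normr0 ltW.
  lra.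
rewrite /scale_weight tch (_ : _ * _ = 8 * n%:R * (av j *
  (2^-1 * h * Num.min 1 ((3 * rs j / (h / 2)) ^+ n)))); last first.
  by rewrite /ball_mass; field.
rewrite ler_wpM2l ?mulr_ge0// ler_pM2l// le_min; apply/andP; split.
  rewrite (_ : 3 * rs j / (h / 2) = 6 * (rs j / h)); last by field; rewrite gt_eqF.
  rewrite [leRHS]mulrCA -exprMn -mulrA mulrCA ler_pM2l//.
  have q0 : 0 <= rs j / h by rewrite divr_ge0 ?(ltW (rs0 j)) ?(ltW h0).
  set q := rs j / h in q0 *; clearbody q.
  have m0 : 0 <= Num.min 1 ((6 * q) ^+ n) by rewrite le_min ler01 /= exprn_ge0// mulr_ge0.
  apply: (@le_trans _ _ (1 * (6 * q) ^+ n)).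
    by apply: ler_pM => //; [lra|rewrite ge_min lexx orbT].
  by rewrite mul1r; apply: lerXn2r; rewrite ?nnegrE ?mulr_ge0//; lra.
apply: (@le_trans _ _ (2^-1 * h * 1)).
  by rewrite ler_wpM2l ?mulr_ge0 ?(ltW h0)// ge_min lexx.
by have := hb; have := h0; lra.
Qed.

Lemma scale_step (e : R) : 0 < e -> exists N0, forall N, (N0 <= N)%N ->
  `|cube_avg N (h / 2) (cell (h / 2) (gam a)) - cube_avg N h (cell h (gam b))| <=
    2 * \sum_(0 <= j < N) scale_weight x b h j + e.
Proof.
move=> e0; have e2 : 0 < e / 2 by rewrite divr_gt0.
have [N1 H1] := curve_mass e2; have [N2 H2] := halving_mass e2.
exists (maxn N1 N2) => N; rewrite geq_max => /andP[/H1 {}H1 /H2 {}H2].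
rewrite distrC in H1.
rewrite (_ : _ - _ = (cube_avg N (h / 2) (cell (h / 2) (gam a)) - cube_avg N h (cell h (gam a))) +
  (cube_avg N h (cell h (gam a)) - cube_avg N h (cell h (gam b)))); last by ring.
apply: (le_trans (ler_normD _ _)); apply: (le_trans (lerD H2 H1)); lra.
Qed.

End ScaleStep.

(** * Summation over the scales *)

Section Geometric.
Context {R : realType}.
Implicit Types (b : nat -> R) (q B : R).

(** The terms grow with [k], so the last admissible one dominates: the terms up to it sum to at most
    that term divided by 1 - q. *)
Lemma geometric_incr_sum b q B K : (forall k, 0 < b k) -> 0 < q -> q < 1 ->
  (forall k, b k = q * b k.+1) -> 0 <= B ->
  \sum_(0 <= k < K | b k <= B) b k <= B / (1 - q).
Proof.
move=> b0 q0 q1 bS B0; have p0 : 0 < 1 - q by rewrite subr_gt0.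
have full K' : \sum_(0 <= k < K') b k <= q * b K' / (1 - q).
  elim: K' => [|K' IH]; first by rewrite big_geq// divr_ge0 ?mulr_ge0 ?(ltW q0) ?(ltW p0) ?(ltW (b0 _)).
  rewrite big_nat_recr//= -bS ler_pdivlMr// mulrDl.
  by move: IH; rewrite ler_pdivlMr// => IH; lra.
elim: K => [|K IH]; first by rewrite big_geq// divr_ge0 ?(ltW p0).
rewrite big_mkcond big_nat_recr//= -big_mkcond /=; case: ifPn => [bB|_]; last by rewrite addr0.
apply: (@le_trans _ _ (q * b K / (1 - q) + b K)).
  rewrite lerD2r; apply: le_trans (full K); rewrite big_mkcond.
  by apply: ler_sum => k _; case: ifP => // _; exact: ltW.
rewrite ler_pdivlMr// mulrDl divfK ?gt_eqF//; lra.
Qed.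

(** The terms decrease, so the first admissible one dominates; the induction shifts the sequence
    until that term comes first. *)
Lemma geometric_decr_sum b q B K : (forall k, 0 < b k) -> 0 < q -> q < 1 ->
  (forall k, b k.+1 = q * b k) -> 0 <= B ->
  \sum_(0 <= k < K | b k <= B) b k <= B / (1 - q).
Proof.
move=> + q0 q1 + B0; have p0 : 0 < 1 - q by rewrite subr_gt0.
elim: K b => [|K IH] b b0 bS; first by rewrite big_geq// divr_ge0 ?(ltW p0).
have full K' : \sum_(0 <= k < K') b k = (b 0%N - b K') / (1 - q).
  elim: K' => [|K' IH']; first by rewrite big_geq// subrr mul0r.
  by rewrite big_nat_recr//= IH' bS; field; rewrite gt_eqF.
have [bB|Bb] := leP (b 0%N) B.
  apply: (@le_trans _ _ (\sum_(0 <= k < K.+1) b k)).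
    by rewrite big_mkcond; apply: ler_sum => k _; case: ifP => // _; exact: ltW.
  rewrite full ler_pM2r ?invr_gt0//; have := b0 K.+1; lra.
rewrite big_mkcond big_nat_recl//= [b 0%N <= B]leNgt Bb /= add0r -big_mkcond /=.
exact: (IH (fun k => b k.+1)).
Qed.

End Geometric.

Section ScaleSum.
Context {R : realType}.
Variables (n : nat) (s L rho : R).
Hypotheses (n2 : (2 <= n)%N) (s1 : 1 <= s) (L0 : 0 < L) (rho0 : 0 < rho).
Hypothesis sn : s * (n%:R - 1) < n%:R.

Let sigma := s * (n%:R - 1).
(** Chosen so that [time_scale] to the power [s], the John lower bound for the distance to the
    boundary, is halved at each step exactly as [mesh] is. *)
Definition ratio : R := 2^-1 `^ s^-1.
Definition time_scale k : R := L * ratio ^+ k.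
Definition mesh k : R := rho / 2 ^+ k.

(** The two fractions are the sums of the geometric series of ratios ratio^sigma and ratio^(n -
    sigma), one for each entry of the minimum in [scale_weight]. The second converges because sigma
    < n. *)
Definition potential_cst : R :=
  8 * n%:R * 6 `^ sigma * (24 ^+ n * (L `^ sigma / rho ^+ n.-1) / (1 - ratio `^ sigma) +
    3 * L `^ (1 - (n%:R - sigma)) / (1 - ratio `^ (n%:R - sigma))).

Let s0 : 0 < s. Proof. exact: lt_le_trans s1. Qed.
Let nR : 1 <= n%:R - 1 :> R.
Proof. by rewrite lerBrDr (_ : 1 + 1 = 2%:R)// ler_nat. Qed.
Let sigma0 : 0 < sigma. Proof. by rewrite mulr_gt0// (lt_le_trans ltr01 nR). Qed.
Let sigma_n1 : n%:R - 1 <= sigma.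
Proof. by rewrite ler_peMl// (le_trans ler01 nR). Qed.

Lemma ratio_gt0 : 0 < ratio. Proof. exact: powR_gt0. Qed.
Let powR_lt1 (y p : R) : 0 <= y -> y < 1 -> 0 < p -> y `^ p < 1.
Proof.
move=> y0 y1 p0; have := @gt0_ltr_powR _ _ p0 y 1.
by rewrite powR1 !nnegrE => ->.
Qed.

Lemma ratio_lt1 : ratio < 1.
Proof. by apply: powR_lt1; rewrite ?invr_gt0//; lra. Qed.

Lemma time_scale_gt0 k : 0 < time_scale k.
Proof. by rewrite mulr_gt0// exprn_gt0// ratio_gt0. Qed.

Lemma time_scaleS k : time_scale k.+1 = ratio * time_scale k.
Proof. by rewrite /time_scale exprS mulrCA. Qed.

Lemma time_scale_le k : time_scale k <= L.
Proof.
rewrite ler_piMr ?(ltW L0)// exprn_ile1 ?(ltW ratio_gt0)//.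
exact/ltW/ratio_lt1.
Qed.

Lemma time_scale_cvg0 (e : R) : 0 < e -> exists K, time_scale K <= e.
Proof.
move=> e0; have : `|ratio| < 1 by rewrite ger0_norm ?ratio_lt1// ltW// ratio_gt0.
move=> /cvg_expr/(_ _ (nbhsx_ballx _ _ (divr_gt0 e0 L0)))[K _ /(_ K (leqnn K))].
rewrite -ball_normE /= sub0r normrN ger0_norm ?exprn_ge0 ?(ltW ratio_gt0)// => h.
by exists K; rewrite /time_scale mulrC -ler_pdivlMr// ltW.
Qed.

Lemma mesh_gt0 k : 0 < mesh k. Proof. by rewrite divr_gt0// exprn_gt0. Qed.

Lemma meshS k : mesh k.+1 = mesh k / 2.
Proof. by rewrite /mesh exprSr invfM mulrA. Qed.

Lemma time_scale_powR k : time_scale k `^ s = L `^ s / 2 ^+ k.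
Proof.
rewrite powRM ?exprn_ge0 ?(ltW ratio_gt0) ?(ltW L0)//; congr (_ * _).
have ratio_s : ratio `^ s = 2^-1.
  by rewrite /ratio -powRrM mulVf ?gt_eqF// powRr1 ?invr_ge0.
rewrite -powR_mulrn ?(ltW ratio_gt0)// powRAC ratio_s.
by rewrite powR_mulrn ?invr_ge0// exprVn.
Qed.

Lemma mesh_le_time_scale k : rho <= L -> mesh k <= time_scale k.
Proof.
move=> rL; apply: ler_pM; rewrite ?(ltW rho0) ?invr_ge0 ?exprn_ge0//.
rewrite -exprVn; apply: lerXn2r; rewrite ?nnegrE ?invr_ge0 ?(ltW ratio_gt0)//.
rewrite -[leLHS]powRr1 ?invr_ge0//; apply: ger_powR; last by rewrite invf_le1.
by apply/andP; split; lra.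
Qed.

(** The origin of the exponent: [mesh] is proportional to the power [s] of [time_scale], so its
    power n - 1 is proportional to the power sigma = s (n - 1). *)
Let mesh_pow k : (mesh k ^+ n.-1)^-1 = L `^ sigma / rho ^+ n.-1 * time_scale k `^ (- sigma).
Proof.
have n1 : n.-1%:R = n%:R - 1 :> R by rewrite -subn1 natrB// ltnW.
have -> : time_scale k `^ (- sigma) = (L `^ sigma)^-1 * 2 ^+ k ^+ n.-1.
  rewrite powRN /sigma powRrM time_scale_powR -n1 powR_mulrn; last first.
    by rewrite divr_ge0 ?powR_ge0 ?exprn_ge0.
  by rewrite exprMn invfM exprVn invrK powRrM powR_mulrn ?powR_ge0.
rewrite mulrA [_ / _ / _]mulrAC mulfV ?gt_eqF ?powR_gt0// mul1r.
by rewrite /mesh exprMn invfM exprVn invrK.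
Qed.

(** Put D = r + |x - x_j|. Scales T >= r that reach the ball have T >= D / 6 and contribute r^n
    T^(-sigma), a series dominated by its value at D / 6. Scales T < r can reach it only if D <= 6r,
    and contribute T^(n - sigma) up to a constant, a series dominated by r^(n - sigma). *)
Lemma scale_weight_sum (xs : nat -> 'rV[R]_n) (rs av : nat -> R) x j K :
  0 < rs j -> 0 < av j ->
  2 * \sum_(0 <= k < K) scale_weight xs rs av x (time_scale k) (mesh k) j <=
  2 * (potential_cst * (av j * rs j ^+ n * (rs j + `|x - xs j|) `^ (- sigma))).
Proof.
rewrite /scale_weight; set r := rs j; set a := av j; set D := r + _ => r0 a0.
have D0 : 0 < D by rewrite /D ltr_wpDr.
have D60 : 0 < D / 6 by rewrite divr_gt0.
set th := n%:R - sigma.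
have th0 : 0 < th by rewrite /th subr_gt0.
have th1 : th <= 1 by rewrite /th; have := sigma_n1; lra.
set kap := L `^ sigma / rho ^+ n.-1.
have kap0 : 0 <= kap by rewrite /kap divr_ge0 ?powR_ge0 ?exprn_ge0 ?(ltW rho0).
rewrite ler_pM2l//.
pose b1 k := time_scale k `^ (- sigma); pose b2 k := time_scale k `^ th.
pose B1 := (D / 6) `^ (- sigma); pose B2 := r `^ th.
pose A1 := 24 ^+ n * kap * r ^+ n; pose A2 := 3 * L `^ (1 - th).
have A10 : 0 <= A1 by rewrite /A1 mulr_ge0 ?exprn_ge0 ?(ltW r0)// mulr_ge0 ?exprn_ge0.
have A20 : 0 <= A2 by rewrite /A2 mulr_ge0 ?powR_ge0.
have powN (y z : R) : 0 < y -> y <= z -> z `^ (- sigma) <= y `^ (- sigma).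
  move=> y0 yz; have z0 := lt_le_trans y0 yz.
  rewrite !powRN lef_pV2 ?posrE ?powR_gt0//.
  by apply: ge0_ler_powR; rewrite ?nnegrE ?(ltW y0) ?(ltW z0) ?(ltW sigma0).
pose ind := (D <= 6 * r)%R.
have ib1 k : 0 <= (if b1 k <= B1 then b1 k else 0) by case: ifP => // _; exact: powR_ge0.
have ib2 k : 0 <= (if b2 k <= B2 then b2 k else 0) by case: ifP => // _; exact: powR_ge0.
have iA2 : 0 <= ind%:R * A2 by rewrite mulr_ge0.
have term k : (if D <= 2 * r + 4 * time_scale k then
     8 * n%:R * (a * Num.min (24 ^+ n * (mesh k * (r / mesh k) ^+ n)) (3 * time_scale k)) else 0)
   <= 8 * n%:R * a * (A1 * (if b1 k <= B1 then b1 k else 0) +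
        ind%:R * A2 * (if b2 k <= B2 then b2 k else 0)).
  have T0 := time_scale_gt0 k.
  have rhs0 : 0 <= A1 * (if b1 k <= B1 then b1 k else 0) +
        ind%:R * A2 * (if b2 k <= B2 then b2 k else 0).
    by apply: addr_ge0; exact: mulr_ge0.
  case: ifP => [Dk|_]; last by rewrite mulr_ge0// mulr_ge0 ?(ltW a0)// mulr_ge0.
  rewrite -[leRHS]mulrA ler_wpM2l ?mulr_ge0// ler_pM2l//.
  have [rT|Tr] := leP r (time_scale k).
    have -> : b1 k <= B1 by apply: powN => //; rewrite ler_pdivrMr// mulrC; lra.
    rewrite -[leLHS]addr0; apply: lerD; last first.
      exact: mulr_ge0.
    rewrite ge_min; apply/orP; left.
    have hE : mesh k ^+ n = mesh k * mesh k ^+ n.-1 by rewrite -exprS prednK// ltnW.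
    have -> : mesh k * (r / mesh k) ^+ n = r ^+ n * (mesh k ^+ n.-1)^-1.
      by rewrite expr_div_n hE; field; rewrite expf_neq0 gt_eqF ?mesh_gt0.
    rewrite mesh_pow -/kap -/(b1 k) /A1 le_eqVlt; apply/orP; left; apply/eqP; ring.
  have i1 : ind by rewrite /ind; lra.
  rewrite i1 mul1r.
  have -> : b2 k <= B2.
    by apply: ge0_ler_powR; rewrite ?nnegrE ?(ltW r0) ?(ltW T0) ?(ltW th0) ?(ltW Tr).
  rewrite -[leLHS]add0r; apply: lerD.
    exact: mulr_ge0.
  rewrite ge_min; apply/orP; right.
  rewrite /A2 /b2 -mulrA ler_pM2l//.
  rewrite -[leLHS]powRr1 ?(ltW T0)// -[X in _ `^ X <= _](subrK th) powRD; last first.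
    by rewrite (gt_eqF T0) implybT.
  rewrite ler_wpM2r ?powR_ge0//.
  by apply: ge0_ler_powR; rewrite ?nnegrE ?subr_ge0 ?(ltW T0) ?(ltW L0) ?time_scale_le.
apply: (le_trans (ler_sum _ (fun k _ => term k))).
rewrite -mulr_sumr big_split /= -!mulr_sumr -!big_mkcond /=.
have g1 : \sum_(0 <= k < K | b1 k <= B1) b1 k <= B1 / (1 - ratio `^ sigma).
  apply: geometric_incr_sum.
  - by move=> k; apply/powR_gt0/time_scale_gt0.
  - by apply/powR_gt0/ratio_gt0.
  - by apply: powR_lt1 => //; [exact/ltW/ratio_gt0|exact/ratio_lt1].
  - move=> k; rewrite /b1 time_scaleS powRM ?(ltW ratio_gt0) ?(ltW (time_scale_gt0 k))//.
    rewrite mulrA -powRD; last by rewrite (gt_eqF ratio_gt0) implybT.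
    by rewrite subrr powRr0 mul1r.
  - exact: powR_ge0.
have g2 : \sum_(0 <= k < K | b2 k <= B2) b2 k <= B2 / (1 - ratio `^ th).
  apply: geometric_decr_sum.
  - by move=> k; apply/powR_gt0/time_scale_gt0.
  - by apply/powR_gt0/ratio_gt0.
  - by apply: powR_lt1 => //; [exact/ltW/ratio_gt0|exact/ratio_lt1].
  - by move=> k; rewrite /b2 time_scaleS powRM ?(ltW ratio_gt0) ?(ltW (time_scale_gt0 k)).
  - exact: powR_ge0.
have q1 : 0 < 1 - ratio `^ sigma.
  by rewrite subr_gt0 powR_lt1 ?(ltW ratio_gt0) ?ratio_lt1.
have q2 : 0 < 1 - ratio `^ th.
  by rewrite subr_gt0 powR_lt1 ?(ltW ratio_gt0) ?ratio_lt1.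
(* Here r^(n - sigma) = r^n r^(-sigma), and D <= 6r replaces the last factor by (D / 6)^(-sigma). *)
have B2le : ind%:R * B2 <= r ^+ n * B1.
  rewrite /ind; case: (boolP (D <= 6 * r)) => [Dr|_]; last first.
    by rewrite mul0r mulr_ge0 ?powR_ge0 ?exprn_ge0 ?(ltW r0).
  rewrite mul1r /B2 /th powRD ?(gt_eqF r0) ?implybT// powR_mulrn ?(ltW r0)//.
  rewrite ler_pM2l ?exprn_gt0//; apply: powN => //.
  by rewrite ler_pdivrMr// mulrC.
apply: (@le_trans _ _ (8 * n%:R * a * (A1 * (B1 / (1 - ratio `^ sigma)) +
    A2 * (r ^+ n * B1 / (1 - ratio `^ th))))).
  rewrite ler_wpM2l ?mulr_ge0 ?(ltW a0)//; apply: lerD; first exact: ler_wpM2l.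
  rewrite [ind%:R * A2]mulrC -[leLHS]mulrA ler_wpM2l//.
  apply: (@le_trans _ _ (ind%:R * (B2 / (1 - ratio `^ th)))).
    by rewrite ler_wpM2l.
  by rewrite mulrA ler_wpM2r// invr_ge0 ltW.
have -> : B1 = 6 `^ sigma * D `^ (- sigma).
  rewrite /B1 powRM ?invr_ge0 ?(ltW D0)// mulrC; congr (_ * _).
  by rewrite -(powR_inv1 (_ : 0 <= 6)) ?ler0n// -powRrM mulrNN mul1r.
rewrite le_eqVlt; apply/orP; left; apply/eqP.
rewrite /A1 /A2 /potential_cst -/sigma -/th -/kap.
set X1 := (1 - _)^-1; set X2 := (1 - _)^-1; ring.
Qed.

End ScaleSum.

(** * The pointwise potential bound *)

Section Potential.
Context {R : realType} {n : nat}.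
Variables (Om : set 'rV[R]_n) (u g : 'rV[R]_n -> R) (s L c0 : R).
Variables (xs : nat -> 'rV[R]_n) (rs av : nat -> R).
Hypotheses (n2 : (2 <= n)%N) (s1 : 1 <= s) (sn : s * (n%:R - 1) < n%:R).
Hypotheses (L0 : 0 < L) (c00 : 0 < c0).
Hypothesis oOm : open Om.
Hypotheses (rs0 : forall j, 0 < rs j) (av0 : forall j, 0 < av j).
Hypothesis g0 : forall v, 0 <= g v.
Hypothesis cg : forall v, Om v -> {for v, continuous g}.
Hypothesis du : forall i v, Om v -> derivable u v (evec R i).
Hypothesis gu : forall i v, Om v -> `|partial u i v| <= g v.
Hypothesis dom : forall v, Om v -> 0 < g v -> exists j, `|v - xs j| < rs j /\ g v < av j.

(** The first entry keeps cubes of radius three meshes inside the John tube at every scale; the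
    second gives [mesh] <= [time_scale]. *)
Definition base_mesh : R := Num.min (c0 * L `^ s / 8) L.
Let rho := base_mesh.
Let T := time_scale s L.
Let h := mesh rho.

Lemma base_mesh_gt0 : 0 < base_mesh.
Proof. by rewrite lt_min L0 andbT divr_gt0// mulr_gt0// powR_gt0. Qed.

(** The scale steps telescope from the cube at arc length [T K] to the one containing [x0], which
    does not depend on [x]. For large [K] the first average is close to [u x], and the weights are
    summed over the scales for each ball separately. The threshold [N0] may depend on [x] and [e],
    the constant does not. *)
Lemma pointwise_potential (x x0 : 'rV[R]_n) (gam : R -> 'rV[R]_n) (e : R) : Om x -> 0 < e ->
  gam 0 = x -> gam L = x0 ->
  (forall t t', 0 <= t -> t <= t' -> t' <= L -> `|gam t' - gam t| <= t' - t) ->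
  (forall t, 0 <= t <= L -> forall z, `|z - gam t| < c0 * t `^ s -> Om z) ->
  exists N0, forall N, (N0 <= N)%N ->
  `|u x - cube_avg u N base_mesh (cell base_mesh x0)| <=
    2 * potential_cst n s L base_mesh *
      \sum_(0 <= j < N) av j * rs j ^+ n *
        (rs j + `|x - xs j|) `^ (- (s * (n%:R - 1))) + e.
Proof.
move=> Ox e0 gam0 gamL lip tube; have rho0 := base_mesh_gt0.
have T0 k : 0 < T k by apply: time_scale_gt0.
have TL k : T k <= L by apply: time_scale_le.
have h0 k : 0 < h k by apply: mesh_gt0.
have hT k : h k <= T k by apply: mesh_le_time_scale => //; rewrite ge_min lexx orbT.
have TS k : T k.+1 <= T k.
  rewrite /T time_scaleS ler_piMl ?(ltW (T0 k))//.
  exact/ltW/ratio_lt1.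
have chain K e' : 0 < e' -> exists N0, forall N, (N0 <= N)%N ->
  `|cube_avg u N (h K) (cell (h K) (gam (T K))) - cube_avg u N (h 0%N) (cell (h 0%N) (gam (T 0%N)))| <=
    \sum_(0 <= j < N) 2 * (\sum_(0 <= k < K) scale_weight xs rs av x (T k) (h k) j) + e'.
  elim: K e' => [|K IH] e' e'0.
    exists 0%N => N _; rewrite subrr normr0 addr_ge0 ?(ltW e'0)//.
    by apply: sumr_ge0 => j _; rewrite big_geq// mulr0.
  have e2 : 0 < e' / 2 by rewrite divr_gt0.
  have [N1 H1] := IH _ e2.
  have lipK t t' : 0 <= t -> t <= t' -> t' <= T K -> `|gam t' - gam t| <= t' - t.
    by move=> t0 tt' t'T; apply: lip => //; exact: le_trans (TL K).
  have tubeK t : T K.+1 <= t -> t <= T K -> forall v, `|v - gam t| <= 3 * h K -> Om v.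
    move=> Tt tT v vt; have t0 : 0 <= t by apply: le_trans Tt; exact: ltW.
    apply: (tube t); first by rewrite t0 (le_trans tT).
    apply: (le_lt_trans vt); apply: (@lt_le_trans _ _ (c0 * T K.+1 `^ s)); last first.
      rewrite ler_pM2l//; apply: ge0_ler_powR => //; rewrite ?nnegrE ?(ltW (T0 _))//.
      exact: le_trans s1.
    (* The John radius at T (k+1) is c0 L^s / 2^(k+1), and three meshes are at most 3/8 of c0 L^s /
       2^k, which is strictly less. *)
    rewrite time_scale_powR// exprSr invfM /h /mesh !mulrA.
    have p0 : 0 < (2 ^+ K)^-1 :> R by rewrite invr_gt0 exprn_gt0.
    rewrite [ltRHS]mulrAC ltr_pM2r//.
    have : rho <= c0 * L `^ s / 8 by rewrite ge_min lexx.
    have : 0 < c0 * L `^ s by rewrite mulr_gt0// powR_gt0.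
    by move=> ? ?; lra.
  have [N2 H2] := scale_step rs0 av0 cg du gu dom (ltW (T0 K.+1)) (TS K) (h0 K) (hT K)
    gam0 lipK tubeK e2.
  exists (maxn N1 N2) => N; rewrite geq_max => /andP[/H1 {}H1 /H2 {}H2].
  rewrite (_ : h K.+1 = h K / 2); last exact: meshS.
  set A := cube_avg u N (h K / 2) _ in H2 *; set B := cube_avg u N (h K) _ in H1 H2.
  set C := cube_avg u N (h 0%N) _ in H1 *.
  have -> : A - C = (A - B) + (B - C) by ring.
  apply: (le_trans (ler_normD _ _)); apply: (le_trans (lerD H2 H1)).
  rewrite le_eqVlt; apply/orP; left; apply/eqP.
  under [in RHS]eq_bigr => j _ do rewrite big_nat_recr//= mulrDr.
  by rewrite big_split /= -!mulr_sumr; lra.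
have e2 : 0 < e / 2 by rewrite divr_gt0.
have [eta eta0 Heta] := grid_avg_point oOm g0 cg du gu Ox e2.
have [K HK] : exists K, T K <= eta / 2 by apply: time_scale_cvg0 => //; rewrite divr_gt0.
have [N0 H] := chain K _ e2.
exists (maxn 1 N0) => N; rewrite geq_max => /andP[N1 /H {}H].
(* The curve has moved at most [T K] away from [x], and the cube adds at most h K <= T K. *)
have inx : in_cube x (2 * T K) (corner (h K) (cell (h K) (gam (T K)))) (const_mx (h K)).
  move=> i; rewrite [const_mx _ _ _]mxE.
  have /andP[a b] := cellP (gam (T K)) i (h0 K).
  have := le_trans (coord_le_norm _ i) (lip _ _ (lexx 0) (ltW (T0 K)) (TL K)).
  rewrite gam0 subr0 mxE [X in _ + X]mxE ler_distl => /andP[c d].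
  have hk := hT K; have hk0 := h0 K.
  by split; lra.
have r2 : 2 * T K <= eta by move: HK; rewrite ler_pdivlMr// mulrC.
have hx := Heta N N1 _ _ _ r2 inx.
move: H; rewrite (_ : T 0%N = L); last by rewrite /T /time_scale expr0 mulr1.
rewrite (_ : h 0%N = base_mesh); last by rewrite /h /mesh expr0 divr1.
rewrite gamL => H.
set B := cube_avg u N base_mesh _ in H *.
rewrite -[grid_avg _ _ _ _]/(cube_avg u N (h K) (cell (h K) (gam (T K)))) in hx.
set A := cube_avg u N (h K) _ in H hx *.
have -> : u x - B = (u x - A) + (A - B) by ring.
apply: (le_trans (ler_normD _ _)); rewrite distrC.
apply: (le_trans (lerD hx H)).
have W : \sum_(0 <= j < N) 2 * (\sum_(0 <= k < K) scale_weight xs rs av x (T k) (h k) j) <=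
   2 * potential_cst n s L base_mesh *
      \sum_(0 <= j < N) av j * rs j ^+ n *
        (rs j + `|x - xs j|) `^ (- (s * (n%:R - 1))).
  rewrite mulr_sumr; apply: ler_sum => j _; rewrite -[leRHS]mulrA.
  by apply: scale_weight_sum.
lra.
Qed.

End Potential.

(** * Hedberg's splitting of the potential *)

Section Hedberg.
Context {R : realType}.
Variables (n : nat) (sigma M tau : R) (N : nat) (ms D : nat -> R).
Hypotheses (n0 : (0 < n)%N) (sigma0 : 0 < sigma) (sigman : sigma < n%:R).
Hypotheses (M0 : 0 < M) (tau0 : 0 < tau).
Hypotheses (ms0 : forall j, 0 <= ms j) (D0 : forall j, 0 < D j).
Hypothesis massM : \sum_(0 <= j < N) ms j <= M.
Hypothesis mass_tau : forall r, 0 < r -> \sum_(0 <= j < N | D j <= r) ms j <= tau * r ^+ n.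

Definition hedberg_cst : R := 1 + 2 `^ sigma / (1 - 2^-1 `^ (n%:R - sigma)).

(** Points with D j > r0 contribute at most r0^(-sigma) M. The dyadic shells below [r0] are bounded
    by the density hypothesis and form a geometric series of size tau r0^(n - sigma). The radius r0
    = (M / tau)^(1/n) makes both sizes equal. *)
Lemma hedberg_sum : \sum_(0 <= j < N) ms j * D j `^ (- sigma) <=
  hedberg_cst * (M `^ (1 - sigma / n%:R) * tau `^ (sigma / n%:R)).
Proof.
have nR : 0 < n%:R :> R by rewrite ltr0n.
pose r0 : R := (M / tau) `^ (n%:R^-1).
have Mt : 0 < M / tau by rewrite divr_gt0.
have r00 : 0 < r0 by rewrite powR_gt0.
set th := n%:R - sigma.
have th0 : 0 < th by rewrite subr_gt0.
pose rr k : R := r0 / 2 ^+ k.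
have rr0 k : 0 < rr k by rewrite divr_gt0// exprn_gt0.
have rrS k : rr k.+1 = 2^-1 * rr k by rewrite /rr exprS invfM mulrCA.
have powN (y z : R) : 0 < y -> y <= z -> z `^ (- sigma) <= y `^ (- sigma).
  move=> y0 yz; have z0 := lt_le_trans y0 yz.
  rewrite !powRN lef_pV2 ?posrE ?powR_gt0//.
  by apply: ge0_ler_powR; rewrite ?nnegrE ?(ltW y0) ?(ltW z0) ?(ltW sigma0).
(* Finitely many positive distances are involved, so finitely many shells suffice. *)
have [K HK] : exists K, forall j, (j < N)%N -> rr K < D j.
  elim: (N) => [|N' [K IH]]; first by exists 0%N.
  have [K' HK'] : exists K', rr K' < D N'.
    have := @archi_boundP _ (r0 / D N'); rewrite divr_ge0 ?(ltW r00) ?(ltW (D0 _))//.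
    move=> /(_ isT); set K' := Num.bound _; rewrite ltr_pdivrMr// => hK.
    exists K'; rewrite /rr ltr_pdivrMr ?exprn_gt0//; apply: (lt_le_trans hK).
    rewrite mulrC ler_pM2l// -natrX ler_nat; exact/ltnW/ltn_expl.
  have rrle k k' : (k <= k')%N -> rr k' <= rr k.
    move=> /subnK <-; elim: (k' - k)%N => [//|i]; rewrite addSn rrS.
    by apply: le_trans; rewrite ler_piMl ?(ltW (rr0 _))//; lra.
  exists (maxn K K') => j; rewrite ltnS leq_eqVlt => /orP[/eqP ->|/IH hj].
    by apply: le_lt_trans HK'; apply: rrle; rewrite leq_maxr.
  by apply: le_lt_trans hj; apply: rrle; rewrite leq_maxl.
have term j : (j < N)%N -> ms j * D j `^ (- sigma) <= r0 `^ (- sigma) * ms j +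
    \sum_(0 <= k < K) 2 `^ sigma * rr k `^ (- sigma) * (if D j <= rr k then ms j else 0).
  move=> jN; have t0 k : 0 <= 2 `^ sigma * rr k `^ (- sigma) * (if D j <= rr k then ms j else 0).
    by rewrite mulr_ge0 ?mulr_ge0 ?powR_ge0//; case: ifP.
  have [Dr|rD] := leP (D j) r0; last first.
    rewrite -[leLHS]addr0; apply: lerD; last exact: sumr_ge0.
    by rewrite mulrC ler_wpM2r//; apply: powN => //; exact: ltW.
  have ex : exists k, rr k < D j by exists K; exact: HK.
  case: (ex_minnP ex) => k hk mink.
  case: k hk mink => [|k] hk mink; first by move: hk; rewrite /rr expr0 divr1 ltNge Dr.
  have kK : (k < K)%N by apply: mink; exact: HK.
  have Drk : D j <= rr k by rewrite leNgt; apply/negP => /mink; rewrite ltnn.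
  rewrite -[leLHS]add0r; apply: lerD; first by rewrite mulr_ge0 ?powR_ge0.
  rewrite big_mkord (bigD1 (Ordinal kK))//= Drk.
  rewrite -[leLHS]addr0; apply: lerD; last exact: sumr_ge0.
  rewrite mulrC ler_wpM2r//.
  apply: (le_trans (powN _ _ (rr0 k.+1) (ltW hk))).
  rewrite rrS powRM ?invr_ge0 ?(ltW (rr0 k))// ler_wpM2r ?powR_ge0//.
  by rewrite -(powR_inv1 (_ : 0 <= 2)) ?ler0n// -powRrM mulrNN mul1r.
apply: (@le_trans _ _ (r0 `^ (- sigma) * M + 2 `^ sigma * tau * (r0 `^ th / (1 - 2^-1 `^ th)))).
  apply: (@le_trans _ _ (\sum_(0 <= j < N) (r0 `^ (- sigma) * ms j +
    \sum_(0 <= k < K) 2 `^ sigma * rr k `^ (- sigma) * (if D j <= rr k then ms j else 0)))).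
    by rewrite big_nat [leRHS]big_nat; apply: ler_sum => j /andP[_ jN]; exact: term.
  rewrite big_split /= -mulr_sumr; apply: lerD; first by rewrite ler_wpM2l ?powR_ge0.
  rewrite exchange_big /=.
  apply: (@le_trans _ _ (\sum_(0 <= k < K) 2 `^ sigma * tau * rr k `^ th)).
    apply: ler_sum => k _; rewrite -mulr_sumr -big_mkcond /=.
    apply: (@le_trans _ _ (2 `^ sigma * rr k `^ (- sigma) * (tau * rr k ^+ n))).
      by rewrite ler_wpM2l ?mulr_ge0 ?powR_ge0//; exact: mass_tau.
    rewrite /th [n%:R - sigma]addrC powRD ?(gt_eqF (rr0 k)) ?implybT//.
    rewrite powR_mulrn ?(ltW (rr0 k))// le_eqVlt; apply/orP; left; apply/eqP; ring.
  rewrite -mulr_sumr ler_wpM2l ?mulr_ge0 ?powR_ge0 ?(ltW tau0)//.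
  have q0 : 0 < 2^-1 `^ th :> R by rewrite powR_gt0.
  have q1 : 2^-1 `^ th < 1 :> R.
    by have := @gt0_ltr_powR R _ th0 2^-1 1; rewrite powR1 !nnegrE invr_ge0 => ->//; lra.
  have bS k : rr k.+1 `^ th = 2^-1 `^ th * rr k `^ th.
    by rewrite rrS powRM ?invr_ge0// ltW.
  have b0 k : 0 < rr k `^ th by rewrite powR_gt0.
  have b1 k : rr k `^ th <= r0 `^ th.
    elim: k => [|k IH]; first by rewrite /rr expr0 divr1.
    by rewrite bS; apply: le_trans IH; rewrite ler_piMl ?powR_ge0// ltW.
  have := @geometric_decr_sum _ (fun k => rr k `^ th) _ (r0 `^ th) K b0 q0 q1 bS (powR_ge0 _ _).
  by apply: le_trans; rewrite [leRHS]big_mkcond; apply: ler_sum => k _; rewrite b1.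
have E1 : r0 `^ (- sigma) * M = M `^ (1 - sigma / n%:R) * tau `^ (sigma / n%:R).
  rewrite /r0 -powRrM powRM ?invr_ge0 ?(ltW M0) ?(ltW tau0)//.
  rewrite -(powR_inv1 (ltW tau0)) -powRrM mulrAC mulN1r mulrN opprK [n%:R^-1 * _]mulrC.
  by rewrite -[X in _ * X * _](powRr1 (ltW M0)) -powRD ?(gt_eqF M0) ?implybT// addrC.
have E2 : tau * r0 `^ th = M `^ (1 - sigma / n%:R) * tau `^ (sigma / n%:R).
  have e : n%:R^-1 * th = 1 - sigma / n%:R by rewrite /th mulrBr mulVf ?gt_eqF// [_ * sigma]mulrC.
  rewrite /r0 -powRrM e powRM ?invr_ge0 ?(ltW M0) ?(ltW tau0)// mulrCA; congr (_ * _).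
  rewrite -(powR_inv1 (ltW tau0)) -powRrM -{1}[tau](powRr1 (ltW tau0)).
  rewrite -powRD ?(gt_eqF tau0) ?implybT//; congr (_ `^ _); ring.
rewrite E1 /hedberg_cst mulrDl mul1r lerD2l -/th.
rewrite -E2 le_eqVlt; apply/orP; left; apply/eqP; ring.
Qed.

End Hedberg.

(** * Weighted balls from the Choquet integral *)

Section Levels.
Context {R : realType}.

(** The power 2^k for an integer [k] of either sign. *)
Definition level (k : int) : R := expR (k%:~R * ln 2).

Lemma level_gt0 k : 0 < level k. Proof. exact: expR_gt0. Qed.

Let ln20 : 0 < ln 2 :> R. Proof. by rewrite ln_gt0// ltr1n. Qed.

Lemma levelD1 k : level (k + 1) = 2 * level k.
Proof. by rewrite /level intrD1 mulrDl mul1r expRD lnK ?posrE// mulrC. Qed.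

Lemma level_le k k' : (k <= k')%R -> level k <= level k'.
Proof. by move=> kk; rewrite ler_expR ler_pM2r// ler_int. Qed.

Lemma level_bracket (f : R) : 0 < f -> exists k, level k < f <= 2 * level k.
Proof.
move=> f0; pose y := ln f / ln 2; exists (Num.ceil y - 1)%R.
have fE : f = expR (y * ln 2) by rewrite divfK ?gt_eqF// lnK.
rewrite -levelD1 subrK fE /level ltr_expR ler_expR ltr_pM2r// ler_pM2r//.
by rewrite ceil_ge andbT ceilB1_lt.
Qed.

Definition int_enum (p : nat) : int := if odd p then Negz p./2 else Posz p./2.

Lemma int_enum_inj : injective int_enum.
Proof. by move=> p p'; rewrite /int_enum; case: ifP; case: ifP; lia. Qed.

Lemma int_enum_surj k : exists p, int_enum p = k.
Proof.
case: k => k; first by exists k.*2; rewrite /int_enum odd_double doubleK.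
by exists k.*2.+1; rewrite /int_enum /= odd_double /= uphalf_double.
Qed.

(** The intervals from level / 2 (excluded) to level are disjoint and have length level / 2; on each
    of them the nonincreasing [phi] is at least its value at the right end. *)
Lemma dyadic_layers (phi : R -> \bar R) (P : nat) :
  (forall t, (0 <= phi t)%E) -> (forall t t', t <= t' -> (phi t' <= phi t)%E) ->
  (\sum_(0 <= p < P) (level (int_enum p) / 2)%:E * phi (level (int_enum p)) <=
   \int[@lebesgue_measure R]_(t in `[0%R, +oo[%classic) phi t)%E.
Proof.
move=> phi0 phim.
(* Superlevel sets of a monotone function are intervals, whence measurability. *)
have mphi (D : set R) : measurable D -> measurable_fun D phi.
  move=> mD; apply: (measurability _ (ErealGenOInfty.measurableE R)) => //.
  move=> _ [_ [y ->] <-]; apply: measurableI => //; apply: is_interval_measurable.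
  move=> a b /=; rewrite !in_itv/= !andbT => ya yb t /andP[at_ tb].
  by rewrite in_itv /= andbT (lt_le_trans yb)// phim.
pose I p : set R := `](level (int_enum p) / 2), (level (int_enum p))]%classic.
have mI p : measurable (I p) by exact: measurable_itv.
have tI : trivIset [set: nat] I.
  apply/trivIsetP => p p' _ _ pp'; apply/seteqP; split=> // t [].
  rewrite /I /= !in_itv /= => /andP[a1 a2] /andP[b1 b2].
  wlog lt : p p' pp' a1 a2 b1 b2 / (int_enum p < int_enum p')%R.
    move=> W; have [l|l|e] := ltgtP (int_enum p) (int_enum p').
    - exact: (W p p').
    - by apply: (W p' p) => //; rewrite eq_sym.
    - by move/eqP: pp'; apply; exact: int_enum_inj.
  have : level (int_enum p) <= level (int_enum p') / 2.
    rewrite ler_pdivlMr// mulrC -levelD1; apply: level_le; lia.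
  lra.
apply: (@le_trans _ _ (\int[lebesgue_measure]_(t in \big[setU/set0]_(p <- iota 0 P) I p) phi t)%E).
  rewrite ge0_integral_bigsetU//=; first last.
  - by apply: mphi; apply: bigsetU_measurable.
  - by apply: sub_trivIset tI.
  - exact: iota_uniq.
  rewrite /index_iota subn0; apply: lee_sum => p _.
  apply: (@le_trans _ _ (\int[lebesgue_measure]_(t in I p) phi (level (int_enum p)))%E).
    have lI : lebesgue_measure (I p) = (level (int_enum p) / 2)%:E :> \bar R.
      have l0 := level_gt0 (int_enum p).
      rewrite /I lebesgue_measure_itv /= lte_fin ltr_pdivrMr// ifT; last lra.
      by rewrite -EFinB; congr EFin; lra.
    have E := integral_cst (@lebesgue_measure R) (mI p) (phi (level (int_enum p))).
    by rewrite -lI muleC -E.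
  apply: ge0_le_integral => //.
  - exact: mI.
  - exact: (mphi _ (mI p)).
  - by move=> t; rewrite /I /= in_itv /= => /andP[_ tl]; exact: phim.
apply: ge0_subset_integral => //.
- by apply: bigsetU_measurable => p _; exact: mI.
- exact: mphi.
- move=> t; rewrite -bigcup_seq => -[p _]; rewrite /I /= !in_itv /= => /andP[a1 a2].
  by have := level_gt0 (int_enum p); rewrite andbT; lra.
Qed.

End Levels.

(** * Almost optimal coverings of the dyadic superlevel sets *)

Section ChoquetAtoms.
Context {R : realType} {n : nat}.

(** Rearrangement of a finite sum over codes into a double sum: a large square contains all decoded
    pairs, and each pair has at most one code. *)
Lemma uniq_pair_sum (idx : nat -> option (nat * nat)) (G : nat -> nat -> R) (m : nat) :
  (forall j j' pi, idx j = Some pi -> idx j' = Some pi -> j = j') ->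
  (forall p i, 0 <= G p i) ->
  exists P, \sum_(0 <= j < m) (if idx j is Some pi then G pi.1 pi.2 else 0) <=
    \sum_(0 <= p < P) \sum_(0 <= i < P) G p i.
Proof.
move=> inj G0.
have [P HP] : exists P, forall j pi, (j < m)%N -> idx j = Some pi ->
    (pi.1 < P)%N /\ (pi.2 < P)%N.
  elim: m => [|m [P IH]]; first by exists 0%N.
  case e : (idx m) => [pi|].
    exists (maxn P (maxn pi.1 pi.2).+1) => j pi'; rewrite ltnS leq_eqVlt => /orP[/eqP ->|jm].
      by rewrite e => -[<-]; lia.
    by move=> /(IH _ _ jm)[]; lia.
  exists P => j pi'; rewrite ltnS leq_eqVlt => /orP[/eqP ->|jm]; first by rewrite e.
  exact: IH.
exists P; pose b j p i := idx j == Some (p, i).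
apply: (@le_trans _ _ (\sum_(0 <= j < m) \sum_(0 <= p < P) \sum_(0 <= i < P) G p i * (b j p i)%:R)).
  rewrite big_nat [leRHS]big_nat; apply: ler_sum => j /andP[_ jm].
  have nn p : 0 <= \sum_(0 <= i < P) G p i * (b j p i)%:R.
    by apply: sumr_ge0 => i _; rewrite mulr_ge0.
  case e : (idx j) => [[p i]|]; last exact: sumr_ge0.
  have [/= pP iP] := HP _ _ jm e.
  rewrite big_mkord (bigD1 (Ordinal pP))//= -[leLHS]addr0; apply: lerD; last exact: sumr_ge0.
  rewrite big_mkord (bigD1 (Ordinal iP))//= /b e eqxx mulr1 lerDl.
  by apply: sumr_ge0 => i' _; rewrite mulr_ge0.
rewrite exchange_big /=; apply: ler_sum => p _.
rewrite exchange_big /=; apply: ler_sum => i _; rewrite -mulr_sumr ler_piMr//.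
apply: (@sum_unique_le1 _ _ (fun j => b j p i)) => j j' /eqP e /eqP e'.
exact: inj e e'.
Qed.

Lemma half_geometric_sum (eta : R) m : 0 <= eta -> \sum_(0 <= j < m) eta / 2 ^+ j.+1 <= eta.
Proof.
move=> eta0.
have -> : \sum_(0 <= j < m) eta / 2 ^+ j.+1 = eta - eta / 2 ^+ m.
  elim: m => [|m IH]; first by rewrite big_geq// expr0 divr1 subrr.
  by rewrite big_nat_recr//= IH exprS; field; rewrite expf_neq0.
by rewrite gerBl divr_ge0// exprn_ge0.
Qed.

(** Radii are made positive by adding to each r^d a term of a geometric series; the room comes from
    a bound [B'] strictly between the content and [B]. *)
Lemma hcontent_covering_pos (E : set 'rV[R]_n) (d B : R) : 0 < d ->
  (hcontent d E < B%:E)%E ->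
  exists (c : nat -> 'rV[R]_n) (r : nat -> R), [/\ forall i, 0 < r i,
    E `<=` \bigcup_i eball (c i) (r i) &
    forall N, \sum_(0 <= i < N) r i `^ d <= B].
Proof.
move=> d0 EB.
have [B' EB' B'B] : exists2 B', (hcontent d E < B'%:E)%E & B' < B.
  move: EB; have := hcontent_ge0 E d; case: (hcontent d E) => [y| |]//= _.
  rewrite lte_fin => yB; exists ((y + B) / 2); first by rewrite lte_fin; lra.
  lra.
have [c [r [r0 Ec rB]]] := hcontent_covering EB'.
have e0 : 0 < B - B' by rewrite subr_gt0.
pose r' i := (r i `^ d + (B - B') / 2 ^+ i.+1) `^ d^-1.
have t0 i : 0 < (B - B') / 2 ^+ i.+1 by rewrite divr_gt0// exprn_gt0.
have r'd i : r' i `^ d = r i `^ d + (B - B') / 2 ^+ i.+1.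
  by rewrite /r' -powRrM mulVf ?gt_eqF// powRr1// addr_ge0 ?powR_ge0// ltW.
have rr' i : r i <= r' i.
  have -> : r i = (r i `^ d) `^ d^-1 by rewrite -powRrM mulfV ?gt_eqF// powRr1.
  apply: ge0_ler_powR; rewrite ?nnegrE ?powR_ge0// ?invr_ge0 ?(ltW d0)//.
    by rewrite addr_ge0 ?powR_ge0// ltW.
  by rewrite lerDl ltW.
exists c, r'; split=> [i||N].
- by rewrite powR_gt0// ltr_wpDl ?powR_ge0.
- by move=> x /Ec[i _ xi]; exists i => //; exact: lt_le_trans (rr' i).
- under eq_bigr => i _ do rewrite r'd.
  rewrite big_split /=; have := rB N; have := half_geometric_sum N (ltW e0); lra.
Qed.

(* The weighted balls turn the Choquet integral, which is not additive, into a
   sum of masses that can be manipulated as a measure. *)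
Lemma choquet_atoms (Om : set 'rV[R]_n) (g : 'rV[R]_n -> R) (q d lam A : R) :
  0 < q -> 0 < d -> (forall v, 0 <= g v) ->
  choquet d Om (fun x => g x `^ q) = lam%:E -> 8 * lam < A ->
  exists (xs : nat -> 'rV[R]_n) (rs av : nat -> R),
    [/\ forall j, 0 < rs j, forall j, 0 < av j,
      forall v, Om v -> 0 < g v -> exists j, `|v - xs j| < rs j /\ g v < av j &
      forall m, \sum_(0 <= j < m) av j `^ q * rs j `^ d <= A].
Proof.
move=> q0 d0 g0 chE lamA.
pose phi (t : R) := hcontent d [set x | Om x /\ (t < g x `^ q)%R].
pose lev p : R := level (int_enum p).
have lev0 p : 0 < lev p by exact: level_gt0.
have phi0 t : (0 <= phi t)%E by exact: hcontent_ge0.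
have layers P : (\sum_(0 <= p < P) (lev p / 2)%:E * phi (lev p) <= lam%:E)%E.
  rewrite -chE; apply: dyadic_layers => // t t' tt'.
  by apply: hcontent_mono => x [Ox tx]; split=> //; exact: le_lt_trans tx.
(* An infinite content at one level would make a layer sum infinite, whereas these sums are bounded
   by [lam]. *)
have fin p : phi (lev p) \is a fin_num.
  rewrite ge0_fin_numE//; rewrite ltey; apply/eqP => pE.
  have := layers p.+1; rewrite big_nat_recr//= pE gt0_muley ?lte_fin ?divr_gt0//.
  rewrite addey//; rewrite gt_eqF//; apply: (@lt_le_trans _ _ 0%E) => //.
  by apply: sume_ge0 => i _; rewrite mule_ge0// lee_fin divr_ge0// ltW.
pose F p := fine (phi (lev p)).
have F0 p : 0 <= F p by exact: fine_ge0.
have layersR P : \sum_(0 <= p < P) lev p / 2 * F p <= lam.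
  rewrite -lee_fin; apply: le_trans (layers P); rewrite -sumEFin.
  by apply: lee_sum => p _; rewrite EFinM fineK.
(* The slack is halved: one [eta] pays for the excess of the coverings, the other for the indices
   that code no pair. The tolerance [tol] makes the excess at level [p], once multiplied by 4
   [lev p], equal to eta / 2^(p+1). *)
pose eta := (A - 8 * lam) / 2.
have eta0 : 0 < eta by rewrite divr_gt0// subr_gt0.
pose tol p := eta / 2 ^+ p.+1 / (4 * lev p).
have tol0 p : 0 < tol p.
  by apply: divr_gt0; [rewrite divr_gt0// exprn_gt0|rewrite mulr_gt0].
have cov p : exists cr : (nat -> 'rV[R]_n) * (nat -> R), [/\ forall i, 0 < cr.2 i,
    [set x | Om x /\ (lev p < g x `^ q)%R] `<=` \bigcup_i eball (cr.1 i) (cr.2 i) &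
    forall N, \sum_(0 <= i < N) cr.2 i `^ d <= F p + tol p].
  have [|c [r [r0 Ec rB]]] := @hcontent_covering_pos
      [set x | Om x /\ (lev p < g x `^ q)%R] d (F p + tol p) d0.
    by rewrite EFinD fineK// -/(phi (lev p)) lteDl// lte_fin.
  by exists (c, r).
have [cr Hcr] := choice cov.
pose idx j : option (nat * nat) := pickle_inv j.
have idx_inj j j' pi : idx j = Some pi -> idx j' = Some pi -> j = j'.
  rewrite /idx; have := @pickle_invK (nat * nat)%type j; have := @pickle_invK (nat * nat)%type j'.
  by move=> + + e e'; rewrite e e' /= => <- <-.
pose xs j := if idx j is Some pi then (cr pi.1).1 pi.2 else 0.
pose rs j := if idx j is Some pi then (cr pi.1).2 pi.2 else 1.
(* The power g^q is at most twice the level of its bracket, so the factor 4 makes the domination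
   strict; it also yields 8 = 4 * 2 against the layers of weight [lev p] / 2. An index that codes no
   pair keeps radius 1 and a small positive weight. *)
pose aq j := if idx j is Some pi then 4 * lev pi.1 else eta / 2 ^+ j.+1.
pose av j := aq j `^ q^-1.
have aq0 j : 0 < aq j.
  rewrite /aq; case: (idx j) => [pi|]; first by rewrite mulr_gt0.
  by rewrite divr_gt0// exprn_gt0.
have avq j : av j `^ q = aq j.
  by rewrite /av -powRrM mulVf ?gt_eqF// powRr1// ltW.
exists xs, rs, av; split.
- by move=> j; rewrite /rs; case: (idx j) => [pi|//]; have [] := Hcr pi.1.
- by move=> j; rewrite powR_gt0.
- move=> v Ov gv; have fv : 0 < g v `^ q by rewrite powR_gt0.
  have [k /andP[k1 k2]] := level_bracket fv; have [p pk] := int_enum_surj k.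
  rewrite -pk -/(lev p) in k1 k2.
  have [_ /(_ v (conj Ov k1))[i _ vi] _] := Hcr p.
  have ij : idx (pickle (p, i)) = Some (p, i) by rewrite /idx pickleK_inv.
  exists (pickle (p, i)); rewrite /xs /rs /av /aq ij /=; split.
    exact: le_lt_trans (norm_le_enorm _) vi.
  have {1}-> : g v = (g v `^ q) `^ q^-1 by rewrite -powRrM mulfV ?gt_eqF// powRr1// ltW.
  apply: gt0_ltr_powR; rewrite ?invr_gt0// ?nnegrE ?powR_ge0//.
    by rewrite mulr_ge0// ltW.
  by apply: (le_lt_trans k2); rewrite ltr_pM2r// ltr_nat.
move=> m.
pose G p i := 4 * lev p * (cr p).2 i `^ d.
have G0 p i : 0 <= G p i by rewrite !mulr_ge0 ?powR_ge0// ltW.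
have [P HP] := uniq_pair_sum m idx_inj G0.
apply: (@le_trans _ _ (\sum_(0 <= j < m) ((if idx j is Some pi then G pi.1 pi.2 else 0) +
    eta / 2 ^+ j.+1))).
  apply: ler_sum => j _; rewrite avq /aq /rs; case: (idx j) => [pi|].
    by rewrite lerDl divr_ge0 ?exprn_ge0// ltW.
  by rewrite powR1 mulr1 add0r.
rewrite big_split /=.
have h1 : \sum_(0 <= p < P) \sum_(0 <= i < P) G p i <= 8 * lam + eta.
  apply: (@le_trans _ _ (\sum_(0 <= p < P) (8 * (lev p / 2 * F p) + eta / 2 ^+ p.+1))).
    apply: ler_sum => p _; rewrite /G -mulr_sumr.
    have [_ _ rB] := Hcr p.
    apply: (@le_trans _ _ (4 * lev p * (F p + tol p))).
      by rewrite ler_wpM2l ?mulr_ge0 ?(ltW (lev0 p)).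
    rewrite mulrDr /tol [4 * lev p * (_ / _)]mulrC divfK ?gt_eqF ?mulr_gt0//.
    by rewrite lerD2r; lra.
  rewrite big_split /= -mulr_sumr; apply: lerD; first by rewrite ler_pM2l.
  exact/half_geometric_sum/ltW.
have h2 := half_geometric_sum m (ltW eta0).
have e2 : eta + eta = A - 8 * lam by rewrite /eta; lra.
lra.
Qed.

End ChoquetAtoms.

(** * The weak type estimate *)

Section Gradient.
Context {R : realType} {n : nat}.
Variables (Om : set 'rV[R]_n) (u : 'rV[R]_n -> R).

Lemma partial_le_grad_norm (i : 'I_n) v : `|partial u i v| <= grad_norm u v.
Proof.
rewrite -sqrtr_sqr ler_sqrt; last by apply: sumr_ge0 => j _; rewrite sqr_ge0.
by rewrite (bigD1 i) //= lerDl sumr_ge0 // => j _; rewrite sqr_ge0.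
Qed.

Lemma grad_norm_continuous v : open Om -> C1_on Om u -> Om v ->
  {for v, continuous (grad_norm u)}.
Proof.
move=> oOm C1 Ov.
pose S (r : seq 'I_n) (x : 'rV[R]_n) : R := \sum_(i <- r) partial u i x ^+ 2.
have H r : {for v, continuous (S r)}.
  elim: r => [|i r IH].
    have -> : S [::] = cst 0 by apply/funext => x; rewrite /S big_nil.
    exact: cst_continuous.
  have -> : S (i :: r) = partial u i \* partial u i \+ S r.
    by apply/funext => x; rewrite /S big_cons expr2.
  apply: cvgD IH; have [_] := C1 i.
  rewrite (continuous_open_subspace _ oOm) => /(_ v); rewrite inE => /(_ Ov) c.
  exact: (cvgM c c).
apply: (@continuous_comp _ _ _ (fun x => \sum_(i < n) partial u i x ^+ 2) Num.sqrt).
  exact: H.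
exact: sqrt_continuous.
Qed.

End Gradient.

(** * From the potential bound to the content estimate *)

Section Assembly.
Context {R : realType} {n : nat}.
Variables (Om : set 'rV[R]_n) (s delta : R).
Hypotheses (n2 : (2 <= n)%N) (s1 : 1 <= s) (sn : s * (n%:R - 1) < n%:R).
Hypotheses (d0 : 0 < delta) (dn : delta <= n%:R).
Let sigma := s * (n%:R - 1).

(** With masses m_j = a_j r_j^n and q = delta / n, the hypothesis says that the sum of m_j^q is at
    most [A]; as q <= 1, the total mass is at most A^(1/q). Outside the dense set the potential
    bound and Hedberg's bound put every value of [u] within t / 2 of the same cube average, so two
    such values differ by at most [t]. *)
Lemma weak_type_atoms : s_john s Om -> exists C : R, 0 < C /\
  forall u : 'rV[R]_n -> R, C1_on Om u ->
  forall (xs : nat -> 'rV[R]_n) (rs av : nat -> R) (A t : R), 0 < A -> 0 < t ->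
    (forall j, 0 < rs j) -> (forall j, 0 < av j) ->
    (forall v, Om v -> 0 < grad_norm u v ->
       exists j, `|v - xs j| < rs j /\ grad_norm u v < av j) ->
    (forall m, \sum_(0 <= j < m) av j `^ (delta / n%:R) * rs j `^ delta <= A) ->
    exists b, (hcontent delta [set x | Om x /\ (t < `|u x - b|)%R] <=
      (C * t `^ (- (delta / sigma)) * A `^ (n%:R / sigma))%:E)%E.
Proof.
move=> john; have [[oOm _] _] := john.
have [c0 [L [x0 [c00 L0 Ox0 curves]]]] := john_curves s1 john.
have n0 : (0 < n)%N by rewrite ltnW.
have nR : 0 < n%:R :> R by rewrite ltr0n.
have n1R : 0 < n%:R - 1 :> R by rewrite subr_gt0 ltr1n.
have sigma0 : 0 < sigma by rewrite mulr_gt0// (lt_le_trans ltr01 s1).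
set q := delta / n%:R.
have q0 : 0 < q by rewrite divr_gt0.
have q1 : q <= 1 by rewrite ler_pdivrMr// mul1r.
have qn : q * n%:R = delta by rewrite divfK// gt_eqF.
pose rho := base_mesh s L c0.
(* The maxima with 1 make [W] positive without any discussion of the signs of the two constants. *)
pose W : R := Num.max 1 (2 * potential_cst n s L rho) * Num.max 1 (hedberg_cst n sigma).
have W0 : 0 < W by rewrite mulr_gt0// lt_max ltr01.
exists ((24 * n%:R) `^ delta * (2 * W) `^ (delta / sigma)); split.
  by rewrite mulr_gt0// powR_gt0// mulr_gt0.
move=> u C1 xs rs av A t A0 t0 rs0 av0 dom sumA.
pose ms j := av j * rs j ^+ n.
have ms0 j : 0 <= ms j by rewrite mulr_ge0 ?exprn_ge0 ?(ltW (av0 j)) ?(ltW (rs0 j)).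
have msq m : \sum_(0 <= j < m) ms j `^ q <= A.
  apply: le_trans (sumA m); apply: ler_sum => j _.
  rewrite powRM ?exprn_ge0 ?(ltW (av0 j)) ?(ltW (rs0 j))//.
  by rewrite -[rs j ^+ n]powR_mulrn ?(ltW (rs0 j))// -powRrM [_ * q]mulrC qn.
pose M := A `^ q^-1.
have M0 : 0 < M by rewrite powR_gt0.
have msM m : \sum_(0 <= j < m) ms j <= M.
  have S0 : 0 <= \sum_(0 <= j < m) ms j by exact: sumr_ge0.
  have -> : \sum_(0 <= j < m) ms j = ((\sum_(0 <= j < m) ms j) `^ q) `^ q^-1.
    by rewrite -powRrM mulfV ?gt_eqF// powRr1.
  apply: ge0_ler_powR; rewrite ?nnegrE ?powR_ge0 ?invr_ge0 ?(ltW q0) ?(ltW A0)//.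
  by apply: le_trans (msq m); exact: powR_sum_le.
(* The density [tau] is chosen to make [W] times Hedberg's bound exactly t / 2; [y] is the required
   value of tau^(sigma / n). *)
pose y := t / (2 * W * M `^ (1 - sigma / n%:R)).
have y0 : 0 < y by rewrite divr_gt0// mulr_gt0 ?powR_gt0// mulr_gt0.
pose tau := y `^ (n%:R / sigma).
have tau0 : 0 < tau by rewrite powR_gt0.
have tauE : tau `^ (sigma / n%:R) = y.
  by rewrite /tau -powRrM mulrA divfK ?gt_eqF// mulfV ?gt_eqF// powRr1// ltW.
have good x x' : Om x -> Om x' -> ~ dense_set xs ms tau x -> ~ dense_set xs ms tau x' ->
    `|u x - u x'| <= t.
  move=> Ox Ox' gx gx'.
  have one z e : Om z -> ~ dense_set xs ms tau z -> 0 < e -> exists N0, forall N, (N0 <= N)%N ->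
      `|u z - cube_avg u N rho (cell rho x0)| <= t / 2 + e.
    move=> Oz gz e0; have [gam [gam0 gamL lip tube]] := curves z Oz.
    have [N0 H] := @pointwise_potential _ _ Om u (grad_norm u) s L c0 xs rs av n2 s1 sn L0 c00 oOm
      rs0 av0 (fun v => sqrtr_ge0 _) (fun v => grad_norm_continuous oOm C1)
      (fun i v Ov => (C1 i).1 v Ov) (fun i v _ => partial_le_grad_norm u i v) dom
      z x0 gam e Oz e0 gam0 gamL lip tube.
    exists N0 => N /H {}H; apply: (le_trans H); rewrite lerD2r.
    pose D j := rs j + `|z - xs j|.
    have D0 j : 0 < D j by rewrite ltr_wpDr.
    have tm r : 0 < r -> \sum_(0 <= j < N | D j <= r) ms j <= tau * r ^+ n.
      move=> r0; rewrite leNgt; apply/negP => lt; apply: gz; exists r, N; split=> //.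
      apply: (lt_le_trans lt); rewrite big_mkcond [leRHS]big_mkcond.
      apply: ler_sum => j _; case: ifP => [Dj|_]; last by case: ifP.
      rewrite ifT//; apply: le_trans Dj; by rewrite lerDr ltW.
    have := @hedberg_sum R n sigma M tau N ms D n0 sigma0 sn M0 tau0 ms0 D0 (msM N) tm.
    rewrite tauE; set S := \sum_(_ <= _ < _) _ => HS.
    have S0 : 0 <= S by apply: sumr_ge0 => j _; rewrite mulr_ge0 ?powR_ge0.
    have yM : W * (M `^ (1 - sigma / n%:R) * y) = t / 2.
      by rewrite /y; field; rewrite !gt_eqF ?powR_gt0.
    have My0 : 0 <= M `^ (1 - sigma / n%:R) * y by rewrite mulr_ge0 ?powR_ge0 ?(ltW y0).
    rewrite -yM; set X := M `^ _ * y in HS yM My0 *.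
    have -> : W * X = Num.max 1 (2 * potential_cst n s L rho) * (Num.max 1 (hedberg_cst n sigma) * X).
      by rewrite mulrA.
    apply: (@le_trans _ _ (Num.max 1 (2 * potential_cst n s L rho) * S)).
      apply: (@ler_wpM2r _ S S0); by rewrite le_max lexx orbT.
    rewrite ler_wpM2l ?le_max ?ler01//; apply: (le_trans HS).
    by rewrite ler_wpM2r// le_max lexx orbT.
  apply/ler_addgt0Pr => e e0; have e2 : 0 < e / 2 by rewrite divr_gt0.
  have [N1 H1] := one x _ Ox gx e2; have [N2 H2] := one x' _ Ox' gx' e2.
  have {}H1 := H1 (maxn N1 N2) (leq_maxl _ _); have {}H2 := H2 (maxn N1 N2) (leq_maxr _ _).
  set B := cube_avg _ _ _ _ in H1 H2; rewrite distrC in H2.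
  have -> : u x - u x' = (u x - B) + (B - u x') by ring.
  apply: (le_trans (ler_normD _ _)); apply: (le_trans (lerD H1 H2)); lra.
have [b Hb] : exists b, [set x | Om x /\ (t < `|u x - b|)%R] `<=` dense_set xs ms tau.
  (* The constant is the value of [u] at any point outside the dense set; if [Om] has no such point,
     every constant will do. *)
  have [[x' [Ox' gx']]|none] := pselect (exists x', Om x' /\ ~ dense_set xs ms tau x').
    exists (u x') => x [Ox tx]; apply: contrapT => gx.
    by have := good x x' Ox Ox' gx gx'; rewrite leNgt tx.
  by exists 0 => x [Ox _]; apply: contrapT => gx; apply: none; exists x.
exists b; apply: (le_trans (hcontent_mono _ Hb)).
have := dense_set_content xs ms0 tau0 M0 q0 q1 n0 msM msq; rewrite qn.
move=> /le_trans; apply; rewrite lee_fin.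
have tq : tau `^ (- q) = (2 * W) `^ (delta / sigma) * t `^ (- (delta / sigma)) *
    A `^ (n%:R / sigma - 1).
  have e1 : n%:R / sigma * (- q) = - (delta / sigma).
    by rewrite /q; field; rewrite !gt_eqF.
  rewrite /tau -powRrM e1 /y powRM ?invr_ge0 ?(ltW t0)//; last first.
    by rewrite mulr_ge0 ?powR_ge0// mulr_ge0// ltW.
  (* Since M = A^(n / delta), the exponent of [A] is (n / delta) (1 - sigma / n) (delta / sigma) = n
     / sigma - 1; the content bound supplies the missing factor [A]. *)
  have Minv : (2 * W * M `^ (1 - sigma / n%:R))^-1 `^ (- (delta / sigma)) =
      (2 * W) `^ (delta / sigma) * A `^ (n%:R / sigma - 1).
    rewrite -powR_inv1; last by rewrite mulr_ge0 ?powR_ge0// mulr_ge0// ltW.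
    rewrite -powRrM mulrNN mul1r powRM ?powR_ge0//; last by rewrite mulr_ge0// ltW.
    congr (_ * _); rewrite /M -!powRrM; congr (_ `^ _).
    by rewrite /q; field; rewrite !gt_eqF.
  by rewrite Minv; ring.
rewrite tq le_eqVlt; apply/orP; left; apply/eqP.
have -> : A `^ (n%:R / sigma) = A `^ (n%:R / sigma - 1) * A.
  by rewrite -{3}(powRr1 (ltW A0)) -powRD ?subrK// (gt_eqF A0) implybT.
ring.
Qed.

End Assembly.

Unset Implicit Arguments. Set Strict Implicit. Set Printing Implicit Defensive.

Theorem theorem4p9 (R : realType) (n : nat) (Om : set 'rV[R]_n) (s delta : R) :
  (2 <= n)%N -> s_john s Om -> 1 <= s -> s < n%:R / (n%:R - 1) ->
  0 < delta -> delta <= n%:R ->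
  exists c : R, 0 < c /\
    forall u : 'rV[R]_n -> R, C1_on Om u ->
    forall t : R, 0 < t ->
      (ereal_inf [set hcontent delta [set x | Om x /\ (t < `|u x - b|)%R] | b in [set: R]]
       <= c%:E * ((t `^ (- (delta / (s * (n%:R - 1)))))%R)%:E *
          poweR (choquet delta Om (fun x => (grad_norm u x `^ (delta / n%:R))%R))
                (n%:R / (s * (n%:R - 1))))%E.
Proof.
move=> n2 john s1 sn d0 dn.
have nR : 0 < n%:R :> R by rewrite ltr0n ltnW.
have n1R : 0 < n%:R - 1 :> R by rewrite subr_gt0 ltr1n.
have {}sn : s * (n%:R - 1) < n%:R by rewrite -ltr_pdivlMr.
have [C [C0 HC]] := weak_type_atoms n2 s1 sn d0 dn john.
set sigma := s * (n%:R - 1) in sn HC *.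
have sigma0 : 0 < sigma by rewrite mulr_gt0// (lt_le_trans ltr01 s1).
have p0 : 0 < n%:R / sigma by rewrite divr_gt0.
(* The bound requires A > 8 lam strictly; A = 16 lam is taken when lam > 0. *)
exists (C * 16 `^ (n%:R / sigma)); split; first by rewrite mulr_gt0// powR_gt0.
move=> u C1 t t0; set ch := choquet _ _ _; set I := ereal_inf _.
set tp := t `^ _; have tp0 : 0 < tp by rewrite powR_gt0.
have ch0 : (0 <= ch)%E by apply: integral_ge0 => x _; exact: hcontent_ge0.
have bound lam A : ch = lam%:E -> 0 < A -> 8 * lam < A ->
    (I <= (C * tp * A `^ (n%:R / sigma))%:E)%E.
  move=> chE A0 lamA.
  have [xs [rs [av [rs0 av0 dom sumA]]]] := choquet_atoms (divr_gt0 d0 nR) d0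
    (fun v => sqrtr_ge0 _) chE lamA.
  have [b Hb] := HC u C1 xs rs av A t A0 t0 rs0 av0 dom sumA.
  by apply: ge_ereal_inf; exists (hcontent delta [set x | Om x /\ (t < `|u x - b|)%R]) => //; exists b.
case chE : ch ch0 => [lam| |]//.
- rewrite lee_fin le_eqVlt => /orP[/eqP lam0|lam0].
    rewrite -lam0 poweR_EFin powR0 ?gt_eqF// mule0.
    apply/lee_addgt0Pr => e e0; rewrite add0e.
    (* When the integral is zero every positive [A] is admissible, and this one makes the bound
       equal to [e]. *)
    pose A := (e / (C * tp)) `^ (sigma / n%:R).
    have A0 : 0 < A by rewrite powR_gt0// divr_gt0// mulr_gt0.
    apply: (le_trans (bound lam A chE A0 _)); first by rewrite -lam0 mulr0.
    have pp : sigma / n%:R * (n%:R / sigma) = 1 by field; rewrite !gt_eqF.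
    rewrite lee_fin /A -powRrM pp powRr1 ?divr_ge0 ?(ltW e0) ?mulr_ge0 ?(ltW C0) ?(ltW tp0)//.
    by rewrite mulrC divfK// gt_eqF// mulr_gt0.
  apply: (le_trans (bound lam (16 * lam) chE _ _)); rewrite ?mulr_gt0//.
    by rewrite ltr_pM2r// ltr_nat.
  rewrite poweR_EFin -!EFinM lee_fin powRM ?(ltW lam0)//.
  rewrite le_eqVlt; apply/orP; left; apply/eqP; ring.
(* When the integral is infinite, the right-hand side is infinite, as the exponent and the factors
   are positive. *)
- move=> _; rewrite poweRyr ?gt_eqF// -EFinM gt0_muley ?leey// lte_fin mulr_gt0// mulr_gt0// powR_gt0.
Qed.
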